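(* Let $p$ be an odd prime, $q$ a power of $p$, $\ell$ an odd prime with $\ell\ne p$, and $m,n$ positive integers. Let $f=\mathrm{ord}_\ell(q)$. (i) If $f$ is odd, then the LCD cyclic codes of length $2\ell^mp^n$ over $\mathbb F_q$ are exactly the codes generated by $$(X-1)^{\varepsilon_0}(X+1)^{\epsilon_0}\prod_{r=1}^{m}\prod_{k=0}^{\frac{\delta(r)}{2}-1}M_{\ell^{m-r}g^k}(X)^{\varepsilon_k^r}M_{-\ell^{m-r}g^k}(X)^{\varepsilon_k^r}\hat M_{\ell^{m-r}g^k}(-X)^{\sigma_k^r}\hat M_{-\ell^{m-r}g^k}(-X)^{\sigma_k^r},$$ with $\varepsilon_0,\epsilon_0,\varepsilon_k^r,\sigma_k^r\in\{0,p^n\}$, and there are exactly $2^{e+2}$ of them. (ii) If $f$ is even, then the LCD cyclic codes of length $2\ell^mp^n$ over $\mathbb F_q$ are exactly the codes generated by $$\prod_{i=0}^{e}\hat M_{\rho_i}(X)^{\varepsilon_i}\hat M_{\rho_i}(-X)^{\epsilon_i},\qquad \varepsilon_i,\epsilon_i\in\{0,p^n\},$$ and there are exactly $2^{2(e+1)}$ of them.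
   Context: A cyclic code of length $N$ over $\mathbb F_q$ is an ideal of $\mathbb F_q[X]/\langle X^N-1\rangle$; the code generated by $g(X)$ is the ideal generated by its image. A linear code $C$ is LCD (linear complementary dual) if $C\cap C^\perp=\{0\}$, where $C^\perp$ is the Euclidean dual. For a nonzero polynomial $h$ with leading coefficient $c$, $\hat h=c^{-1}h$. For an integer $t$, $C_t=\{tq^i\bmod\ell^m:i\ge0\}$ is the $q$-cyclotomic coset of $t$ modulo $\ell^m$; $\rho_0=0,\rho_1,\dots,\rho_e$ are representatives of all distinct $q$-cyclotomic cosets modulo $\ell^m$ (so there are $e+1$ cosets). $\eta$ is a primitive $\ell^m$-th root of unity in an extension of $\mathbb F_q$, and $M_t(X)=\prod_{s\in C_t}(X-\eta^s)$ is the minimal polynomial of $\eta^t$ over $\mathbb F_q$. $g$ is a fixed generator of $\mathbb Z_{\ell^m}^*$, $\lambda(r)=\mathrm{ord}_{\ell^r}(q)$ and $\delta(r)=\phi(\ell^r)/\lambda(r)$ for $1\le r\le m$ ($\phi$ Euler's function). *)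

(* Defs.v *)
From HB Require Import structures.
From mathcomp Require Import all_boot all_order all_algebra.
From Stdlib Require Import ClassicalEpsilon.
Set Implicit Arguments. Unset Strict Implicit. Unset Printing Implicit Defensive.
Import GRing.Theory.
Local Open Scope ring_scope.

(* Multiplicative order of a modulo N: least k >= 1 with a^k = 1 mod N
   (for gcd(a,N)=1 and N>1 this order is < N, so it is found in iota 0 N). *)
Definition ord_mod (N a : nat) : nat :=
  ((find (fun k => a ^ k.+1 == 1 %[mod N]) (iota 0 N)).+1)%N.

(* q-cyclotomic coset of t modulo N: { t q^i mod N : i >= 0 }.
   (i < N suffices since q^i mod N is purely periodic with period < N
   whenever gcd(q,N)=1.) *)
Definition cyc_coset (N q t : nat) : {set 'I_N} :=
  [set i : 'I_N | [exists j : 'I_N, (i : nat) == (t * q ^ j) %% N]%N].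

(* the set of all distinct q-cyclotomic cosets modulo N (e+1 of them) *)
Definition cyc_cosets (N q : nat) : {set {set 'I_N}} :=
  [set cyc_coset N q (i : nat) | i : 'I_N].

Definition negm (N t : nat) : nat := ((N - t %% N) %% N)%N.

Definition expo (p n : nat) (b : bool) : nat := if b then (p ^ n)%N else 0%N.

Section Codes.
Variable F : finFieldType.

Definition hatp (h : {poly F}) : {poly F} := (lead_coef h)^-1 *: h.
Definition negX (h : {poly F}) : {poly F} := h \Po (- 'X).

(* The ring F[X]/<X^N - 1>, elements represented by coefficient vectors. *)
Definition mulR (N : nat) (u v : 'rV[F]_N) : 'rV[F]_N :=
  poly_rV ((rVpoly u * rVpoly v) %% ('X^N - 1)).

Definition is_cyclic_code (N : nat) (C : {set 'rV[F]_N}) : bool :=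
  [&& (0 \in C), [forall u in C, forall v in C, u + v \in C]
    & [forall a : 'rV[F]_N, forall c in C, mulR a c \in C]].

Definition dual_code (N : nat) (C : {set 'rV[F]_N}) : {set 'rV[F]_N} :=
  [set v : 'rV[F]_N | [forall c in C, v *m c^T == 0]].

Definition is_LCD (N : nat) (C : {set 'rV[F]_N}) : bool :=
  C :&: dual_code C == [set 0].

Definition is_LCD_cyclic (N : nat) (C : {set 'rV[F]_N}) : bool :=
  is_cyclic_code C && is_LCD C.

Definition gen_code (N : nat) (g : {poly F}) : {set 'rV[F]_N} :=
  [set mulR a (poly_rV (g %% ('X^N - 1))) | a : 'rV[F]_N].

Variable L : fieldType.
Variable iota : {rmorphism F -> L}.
Variable eta : L.

Definition MpolyL (N : nat) (C : {set 'I_N}) : {poly L} :=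
  \prod_(s in C) ('X - (eta ^+ s)%:P).

(* the same polynomial, viewed over F (its coefficients lie in F) *)
Definition Mpoly (N : nat) (C : {set 'I_N}) : {poly F} :=
  epsilon (inhabits 0) (fun P : {poly F} => map_poly iota P = MpolyL C).

(* M_t = minimal polynomial of eta^t, t taken modulo N *)
Definition Mt (N q t : nat) : {poly F} := Mpoly (cyc_coset N q t).

Definition gen_i (p q l m n g : nat) (b0 c0 : bool) (eps sig : nat -> nat -> bool)
  : {poly F} :=
  let N0 := (l ^ m)%N in
  ('X - 1) ^+ expo p n b0 * ('X + 1) ^+ expo p n c0 *
  \prod_(1 <= r < m.+1)
    \prod_(0 <= k < (totient (l ^ r)%N %/ ord_mod (l ^ r)%N q)./2)
      (let a := (l ^ (m - r) * g ^ k)%N in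
       Mt N0 q a ^+ expo p n (eps r k) *
       Mt N0 q (negm N0 a) ^+ expo p n (eps r k) *
       hatp (negX (Mt N0 q a)) ^+ expo p n (sig r k) *
       hatp (negX (Mt N0 q (negm N0 a))) ^+ expo p n (sig r k)).

Definition gen_ii (p q l m n : nat) (eps sig : {set 'I_(l ^ m)} -> bool) : {poly F} :=
  \prod_(C in cyc_cosets (l ^ m) q)
     (hatp (Mpoly C) ^+ expo p n (eps C) *
      hatp (negX (Mpoly C)) ^+ expo p n (sig C)).

End Codes.

(* Main.v *)
(** Write [Q = X^N - 1] for the length [N = 2 l^m p^n].  A cyclic code has a monic
    generator [h] dividing [Q], and its dual is read off the conjugation [X |-> X^-1]
    modulo [Q]: the code is LCD iff [h] divides its own conjugate and is coprime to
    [Q / h].  In characteristic [p], [Q] is the [p^n]-th power of the separable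
    polynomial [X^(2 l^m) - 1], whose roots in [L] are the [eta^i] and [- eta^i]; hence
    such an [h] is the [p^n]-th power of the product of the linear factors at a set of
    roots, and being defined over [F] and self-conjugate means that the two sets of
    exponents are stable under multiplication by [q] and by [-1] modulo [l^m].

    If [ord_l q] is even, [-1] is a power of [q] modulo [l^m], so the stable sets are
    the unions of cyclotomic cosets.  If it is odd, [-1] is a power of [q] modulo no
    [l^r], so the nonzero cosets come in pairs of opposites; discrete logarithms in base
    [g] modulo [l^r] show that [l^(m-r) g^k] with [k < delta(r)/2] represents each pair
    exactly once. *)

Require Import Defs.
From HB Require Import structures.
From mathcomp Require Import all_boot all_order all_algebra cyclic finfield.
From mathcomp Require Import zify.
From Stdlib Require Import ClassicalEpsilon.
Set Implicit Arguments. Unset Strict Implicit. Unset Printing Implicit Defensive.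

(** * Arithmetic modulo prime powers *)

Lemma eqn_modMr N k a b : coprime k N -> (a * k == b * k %[mod N]) = (a == b %[mod N]).
Proof.
move=> co; wlog ba : a b / (b <= a) => [H|].
  by case: (leqP b a) => [|/ltnW] /H //; rewrite eq_sym => ->; rewrite eq_sym.
by rewrite !eqn_mod_dvd ?leq_mul2r ?ba ?orbT // -mulnBl Gauss_dvdl // coprime_sym.
Qed.

(** The default of [insubd] is never taken: an [i : 'I_N] forces [N] to be positive. *)
Definition mulI (N k : nat) (i : 'I_N) : 'I_N := insubd i ((i * k) %% N).

Definition mul_stable (N k : nat) (T : {set 'I_N}) : bool := [forall i in T, mulI k i \in T].

Lemma val_mulI N k (i : 'I_N) : mulI k i = ((i * k) %% N) :> nat.
Proof.
by rewrite /mulI val_insubd ltn_mod; case: ltnP => // /(leq_trans (ltn_ord i)); rewrite ltn0.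
Qed.

Lemma mul_stableP N k (T : {set 'I_N}) :
  reflect (forall i, i \in T -> mulI k i \in T) (mul_stable k T).
Proof. exact: forall_inP. Qed.

Lemma mulI_inj N k : coprime k N -> injective (@mulI N k).
Proof.
move=> co i j /(congr1 val); rewrite /= !val_mulI => /eqP.
by rewrite eqn_modMr // !modn_small // => /eqP/val_inj.
Qed.

Lemma mul_stable_imset N k (T : {set 'I_N}) : coprime k N -> mul_stable k T -> mulI k @: T = T.
Proof.
move=> co /mul_stableP sT; apply/eqP.
rewrite eqEcard card_imset ?leqnn ?andbT; last exact: mulI_inj.
by apply/subsetP => _ /imsetP[i iT ->]; apply: sT.
Qed.

Lemma mul_stableC N k (T : {set 'I_N}) : coprime k N -> mul_stable k T -> mul_stable k (~: T).
Proof.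
move=> co sT; apply/mul_stableP => i; rewrite !inE; apply: contra.
by rewrite -{1}(mul_stable_imset co sT) => /imsetP[j jT /(mulI_inj co)->].
Qed.

(* The multiplier [N.-1] is [-1] modulo [N]. *)
Definition stables (q N : nat) : {set {set 'I_N}} :=
  [set T | mul_stable q T && mul_stable N.-1 T].

Lemma card_coprime_ord M : #|[set x : 'I_M | coprime M x]| = totient M.
Proof.
rewrite totient_count_coprime big_mkord -sum1_card.
by rewrite [RHS]big_mkcond [LHS]big_mkcond /=; apply: eq_bigr => i _; rewrite inE; case: coprime.
Qed.

Lemma totient_leq M : totient M <= M.
Proof. by rewrite -card_coprime_ord -[X in _ <= X]card_ord max_card. Qed.

(** * Multiplicative orders and generators of the unit group modulo [M] *)

Section OrdMod.
Variables (M a : nat).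
Hypotheses (M_gt1 : 1 < M) (coaM : coprime a M).

Let M_gt0 : 0 < M. Proof. exact: ltnW. Qed.

(** Euler's theorem supplies the exponent [totient M], which is at most [M] and so within the range
    searched by [ord_mod]; the search succeeds and stops at the least exponent. *)
Lemma expn_ord_mod : a ^ ord_mod M a = 1 %[mod M] /\
  forall k, 0 < k < ord_mod M a -> a ^ k <> 1 %[mod M].
Proof.
pose P k := a ^ k.+1 == 1 %[mod M].
have tM : (totient M).-1 < M by rewrite prednK ?totient_gt0 //; apply: totient_leq.
have hasP : has P (iota 0 M).
  apply/hasP; exists (totient M).-1; first by rewrite mem_iota.
  by rewrite /P prednK ?totient_gt0 // Euler_exp_totient.
have fM : find P (iota 0 M) < M by rewrite -[X in _ < X](size_iota 0) -has_find.
split; first by have := nth_find 0 hasP; rewrite nth_iota // => /eqP.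
case=> // k /= kf; have {}kf : k < find P (iota 0 M) := kf.
have := before_find 0 kf.
by rewrite nth_iota ?(ltn_trans kf fM) // => /eqP.
Qed.

Lemma expn_eq1_mod k : (a ^ k == 1 %[mod M]) = (ord_mod M a %| k).
Proof.
have [e1 min] := expn_ord_mod; set d := ord_mod M a in e1 min *.
have -> : a ^ k = a ^ (k %% d) %[mod M].
  rewrite {1}(divn_eq k d) expnD (mulnC _ d) expnM -modnMml -modnXm e1 modnXm exp1n.
  by rewrite modnMml mul1n.
rewrite /dvdn; case: posnP => [->|y0]; first by rewrite expn0 !eqxx.
by apply/eqP/min; rewrite y0 ltn_mod.
Qed.

Lemma eq_expn_mod i j : (a ^ i == a ^ j %[mod M]) = (i == j %[mod ord_mod M a]).
Proof.
wlog ji : i j / j <= i => [H|].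
  by case: (leqP j i) => [|/ltnW] /H //; rewrite eq_sym => ->; rewrite eq_sym.
rewrite -{1}(subnK ji) expnD -{2}[a ^ j]mul1n eqn_modMr ?coprimeXl //.
by rewrite expn_eq1_mod eqn_mod_dvd.
Qed.

Lemma ord_mod_dvd_totient : ord_mod M a %| totient M.
Proof. by rewrite -expn_eq1_mod Euler_exp_totient. Qed.

(** Counting: the powers with exponent below [totient M] are distinct units, so they exhaust the
    units. *)
Lemma generator_surj u : ord_mod M a = totient M -> coprime u M -> exists j, u = a ^ j %[mod M].
Proof.
move=> oa cou; pose h (k : 'I_(totient M)) : 'I_M := Ordinal (ltn_pmod (a ^ k) M_gt0).
have h_inj : injective h.
  by move=> i j [] /eqP; rewrite eq_expn_mod oa !modn_small // => /eqP/val_inj.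
have hE : [set h k | k : 'I_(totient M)] = [set x : 'I_M | coprime M x].
  apply/eqP; rewrite eqEcard card_coprime_ord card_imset // card_ord leqnn andbT.
  by apply/subsetP => _ /imsetP[k _ ->]; rewrite inE /= coprime_modr coprime_sym coprimeXl.
have : Ordinal (ltn_pmod u M_gt0) \in [set x : 'I_M | coprime M x].
  by rewrite inE /= coprime_modr coprime_sym.
by rewrite -hE => /imsetP[k _ [->]]; exists k.
Qed.

(** Powers with exponent below the order already give every unit, so the order is at least their
    number. This converse lets the generator property descend from [l ^ m] to [l ^ r]. *)
Lemma surj_generator :
  (forall u, coprime u M -> exists j, u = a ^ j %[mod M]) -> ord_mod M a = totient M.
Proof.
move=> sur; apply/eqP; rewrite eqn_leq dvdn_leq ?totient_gt0 ?ord_mod_dvd_totient //=.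
pose h (k : 'I_(ord_mod M a)) : 'I_M := Ordinal (ltn_pmod (a ^ k) M_gt0).
rewrite -card_coprime_ord -[X in _ <= X]card_ord -(card_codom (f := h)); last first.
  by move=> i j [] /eqP; rewrite eq_expn_mod !modn_small // => /eqP/val_inj.
apply/subset_leq_card/subsetP => x; rewrite inE coprime_sym => /sur[j].
rewrite modn_small // => xj; apply/codomP.
exists (Ordinal (ltn_pmod j (isT : 0 < ord_mod M a))); apply: val_inj; rewrite /= xj.
by apply/eqP; rewrite eq_expn_mod modn_mod.
Qed.

End OrdMod.

(** * Powers of [q], and -1, modulo powers of an odd prime *)

Section PrimePower.
Variables (l q : nat).
Hypotheses (l_pr : prime l) (l_odd : odd l) (coql : coprime q l).

Let l_gt1 : 1 < l. Proof. exact: prime_gt1. Qed.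
Let l_gt2 : 2 < l. Proof. by move: l_gt1 l_odd; lia. Qed.
Let lX_gt1 r : 0 < r -> 1 < l ^ r.
Proof. by case: r => // r _; rewrite -(exp1n r.+1) ltn_exp2r. Qed.
Let coqX r : coprime q (l ^ r). Proof. exact: coprimeXr. Qed.
Let q_gt0 : 0 < q.
Proof. by case: q coql => //; rewrite /coprime gcd0n; case: eqP l_gt1 => // ->. Qed.

(** If [l] divided [q ^ d + 1], the odd order of [q] would divide [2 d], hence [d]; then [q ^ d]
    would be both 1 and -1 modulo [l], and [l] would divide 2. *)
Lemma odd_ord_not_opp d : odd (ord_mod l q) -> coprime (q ^ d).+1 l.
Proof.
move=> fo; rewrite coprime_sym prime_coprime //; apply/negP => ld.
have qd0 : 0 < q ^ d by rewrite expn_gt0 q_gt0.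
have : q ^ d == 1 %[mod l].
  rewrite expn_eq1_mod // -(@Gauss_dvdr _ 2) ?coprimen2 // -expn_eq1_mod //.
  rewrite eqn_mod_dvd ?expn_gt0 ?q_gt0 //.
  by rewrite mulnC expnM (subn_sqr _ 1) // addn1 dvdn_mull.
rewrite eqn_mod_dvd // => ld1; have : l %| 2.
  by rewrite -(dvdn_addr _ ld1); have -> : q ^ d - 1 + 2 = (q ^ d).+1 by lia.
by move/dvdn_leq => /(_ isT); rewrite leqNgt l_gt2.
Qed.

(** An odd prime cannot divide both [x - 1] and [x + 1], so all of [l ^ r] goes into one factor. *)
Lemma sqr_eq1_mod_prime_power r x : 0 < x -> x ^ 2 = 1 %[mod l ^ r] ->
  x = 1 %[mod l ^ r] \/ l ^ r %| x.+1.
Proof.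
move=> x0 /eqP; rewrite eqn_mod_dvd ?expn_gt0 ?x0 // (subn_sqr _ 1) addn1 => d.
have [lx|lx] := boolP (l %| x.+1).
  right; move: d; rewrite Gauss_dvdr // coprimeXl // prime_coprime //.
  apply/negP => lx1; have : l %| 2.
    by rewrite -(dvdn_addr _ lx1); have -> : x - 1 + 2 = x.+1 by lia.
  by move/dvdn_leq => /(_ isT); rewrite leqNgt l_gt2.
left; apply/eqP; rewrite eqn_mod_dvd //; move: d.
by rewrite Gauss_dvdl // coprimeXl // prime_coprime.
Qed.

(** The half power squares to 1 and is not 1 by minimality of the order, so it is -1. *)
Lemma even_ord_half r : 0 < r -> ~~ odd (ord_mod (l ^ r) q) ->
  l ^ r %| (q ^ (ord_mod (l ^ r) q)./2).+1.
Proof.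
move=> r0; set d := ord_mod _ _ => dev; have M1 := lX_gt1 r0.
have d2 : d./2 * 2 = d by rewrite muln2 even_halfK.
have d0 : 0 < d by [].
have [] // := @sqr_eq1_mod_prime_power r (q ^ d./2).
- by rewrite expn_gt0 q_gt0.
- by apply/eqP; rewrite -expnM expn_eq1_mod // d2.
- move/eqP; rewrite expn_eq1_mod // -/d => /dvdn_leq; lia.
Qed.

Lemma ord_mod_primeX r : 0 < r -> ord_mod l q %| ord_mod (l ^ r) q.
Proof.
move=> r0; rewrite -expn_eq1_mod //.
have : q ^ ord_mod (l ^ r) q == 1 %[mod l ^ r] by rewrite expn_eq1_mod ?lX_gt1.
by rewrite !eqn_mod_dvd ?expn_gt0 ?q_gt0 //; apply: dvdn_trans; rewrite -{1}(expn1 l) dvdn_exp2l.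
Qed.

Lemma even_ord_opp m : 0 < m -> ~~ odd (ord_mod l q) -> exists j, l ^ m %| (q ^ j).+1.
Proof.
move=> m_gt0 fe; exists (ord_mod (l ^ m) q)./2; apply: even_ord_half => //.
by apply: contra fe; apply: dvdn_odd; exact: ord_mod_primeX.
Qed.

(** Were the order even, -1 would be a power of [q] modulo [l ^ r], hence modulo [l]. *)
Lemma odd_ord_primeX r : 0 < r -> odd (ord_mod l q) -> odd (ord_mod (l ^ r) q).
Proof.
move=> r0 fo; case: (boolP (odd (ord_mod (l ^ r) q))) => // /(even_ord_half r0).
set d := _./2 => h; have := odd_ord_not_opp d fo.
rewrite coprime_sym prime_coprime // => /negP[].
by apply: dvdn_trans h; rewrite -{1}(expn1 l) dvdn_exp2l.
Qed.

Variables m g : nat.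
Hypotheses (m_gt0 : 0 < m) (cogl : coprime g l) (g_gen : ord_mod (l ^ m) g = totient (l ^ m)).

Let N := l ^ m.

Lemma generator_primeX r : 0 < r <= m -> ord_mod (l ^ r) g = totient (l ^ r).
Proof.
case/andP=> r0 rm; apply: surj_generator; rewrite ?lX_gt1 ?coprimeXr // => u.
rewrite coprime_pexpr // => cou.
have [j e] : exists j, u = g ^ j %[mod N].
  by apply: generator_surj; rewrite ?lX_gt1 ?coprimeXr.
have d : l ^ r %| N by rewrite dvdn_exp2l.
by exists j; rewrite -(modn_dvdm u d) e modn_dvdm.
Qed.

Definition delta r := totient (l ^ r) %/ ord_mod (l ^ r) q.

Section Level.
Variable r : nat.
Hypotheses (r_bd : 0 < r <= m) (f_odd : odd (ord_mod l q)).

Let r_gt0 : 0 < r. Proof. by case/andP: r_bd. Qed.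
Let M := l ^ r.
Let M_gt1 : 1 < M. Proof. exact: lX_gt1. Qed.
Let phi := totient M.
Let phi_gt0 : 0 < phi. Proof. by rewrite totient_gt0 ltnW. Qed.
Let d := (delta r)./2.

Lemma gen_surj u : coprime u l -> exists j, u = g ^ j %[mod M].
Proof.
by move=> cou; apply: generator_surj; rewrite ?coprimeXr // generator_primeX.
Qed.

Lemma gen_log i j : (g ^ i == g ^ j %[mod M]) = (i == j %[mod phi]).
Proof. by rewrite eq_expn_mod ?coprimeXr // generator_primeX. Qed.

(* Discrete logarithms [c] of [q] and [w] of [-1] in base [g]: the multiples of
   [2 d = delta r] are those of [c], and [w] is an odd multiple of [d]. *)
Lemma gen_logs : exists c w, [/\ q = g ^ c %[mod M], N.-1 = g ^ w %[mod M],
   forall z, exists t, z * d.*2 = c * t %[mod phi], d %| c &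
   [/\ 0 < d, d %| phi, phi %| w.*2 & exists2 x, w = d * x & odd x]].
Proof.
have N0 : 0 < N by rewrite expn_gt0 ltnW.
have MN : M %| N by rewrite dvdn_exp2l //; case/andP: r_bd.
have lM : l %| M by rewrite -{1}(expn1 l) dvdn_exp2l.
have N1_gt0 : 0 < N.-1 by have := lX_gt1 m_gt0; rewrite -/N; lia.
have coN1 : coprime N.-1 l.
  by have := coprimenS N.-1; rewrite prednK // coprime_pexpr.
have [c qc] := gen_surj coql; have [w Nw] := gen_surj coN1.
exists c, w.
set lam := ord_mod M q.
have lam_odd : odd lam by apply: odd_ord_primeX.
have lam_dvd : lam %| phi by apply: ord_mod_dvd_totient; rewrite ?coprimeXr.
have phiE : delta r * lam = phi by rewrite divnK.
have lamE k : (lam %| k) = (phi %| c * k).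
  rewrite -expn_eq1_mod ?coprimeXr // -modnXm qc modnXm -expnM.
  by rewrite -(expn0 g) gen_log mod0n.
(* The order [lam] of [g ^ c] is [phi / gcd(c, phi)], which identifies the gcd with [phi / lam]. *)
have gE : gcdn c phi = delta r.
  have G0 : 0 < gcdn c phi by rewrite gcdn_gt0 phi_gt0 orbT.
  have lamE' : lam = phi %/ gcdn c phi.
    apply/eqP; rewrite eqn_dvd lamE; apply/andP; split.
      by rewrite muln_divCA_gcd dvdn_mulr.
    have := dvdnn lam; rewrite lamE => h.
    rewrite -(@Gauss_dvdr _ (c %/ gcdn c phi)); last first.
      by rewrite /coprime -(eqn_pmul2r G0) muln_gcdl !divnK ?dvdn_gcdl ?dvdn_gcdr // mul1n gcdnC.
    rewrite -(dvdn_pmul2r G0) divnK ?dvdn_gcdr //.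
    by rewrite mulnAC divnK ?dvdn_gcdl.
  by rewrite /delta -/phi -/lam lamE' divnA ?dvdn_gcdr // mulKn.
have phi_even : ~~ odd phi.
  rewrite /phi /M totient_pfactor // oddM negb_and; case: (l) l_pr l_odd => //= k _ ->; by [].
have del_even : ~~ odd (delta r) by move: phi_even; rewrite -phiE oddM lam_odd andbT.
have dE : d.*2 = delta r by rewrite even_halfK.
have phi2 : phi = d * lam * 2 by rewrite -phiE -dE -muln2 mulnAC.
have d0 : 0 < d by move: phi_gt0; rewrite phi2 !muln_gt0 => /andP[/andP[]].
have w2 : phi %| w.*2.
  have := gen_log w.*2 0; rewrite mod0n /dvdn => <-.
  rewrite expn0 -muln2 expnM -modnXm -Nw modnXm eqn_mod_dvd ?expn_gt0 ?N1_gt0 //.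
  by rewrite (subn_sqr _ 1) addn1 prednK // dvdn_mull.
have wn : ~~ (phi %| w).
  have := gen_log w 0; rewrite mod0n /dvdn => <-.
  rewrite expn0 -Nw eqn_mod_dvd //; apply/negP => h.
  have : M %| 2 by rewrite -(dvdn_addr _ h) addnBAC // addn2 subn1 /= prednK.
  move=> /(dvdn_trans lM)/dvdn_leq => /(_ isT).
  by rewrite leqNgt l_gt2.
split=> //.
(* Bezout over the naturals makes [gcdn c phi + a * c] a multiple of [phi]; the factor [phi.-1] in
   the witness plays the role of -1. *)
- move=> z; have [a _ /dvdnP[b e]] := Bezoutr c phi_gt0.
  exists (z * (a * phi.-1)); rewrite dE -gE.
  apply/eqP; rewrite -(eqn_modDr (z * (a * c))) -mulnDr e.
  have -> : c * (z * (a * phi.-1)) + z * (a * c) = z * a * c * phi.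
    by rewrite -{2}(prednK phi_gt0) mulnS addnC !mulnA (mulnC c) (mulnAC _ c).
  by rewrite mulnA !modnMl.
- by apply: dvdn_trans (dvdn_gcdl c phi); rewrite gE -dE -muln2 dvdn_mulr.
split=> //; first by rewrite phi2 -mulnA dvdn_mulr.
(* Since [phi = 2 d lam], the relation [2 w = y phi] gives [w = d (y lam)]; an even [y] would make
   [phi] divide [w]. *)
have [y wy] := dvdnP w2.
exists (y * lam).
  by apply/eqP; rewrite -(eqn_pmul2r (isT : 0 < 2)) muln2 wy phi2 !mulnA (mulnC y).
rewrite oddM lam_odd andbT; apply: contraNT wn => yev.
apply/dvdnP; exists y./2; move: wy (even_halfK yev).
by move=> wy e; apply: double_inj; rewrite wy -{1}e -!muln2 mulnAC.
Qed.

End Level.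
End PrimePower.

(** * Cyclotomic cosets *)

Section Saturated.
Variables (T : finType) (blk : T -> {set T}).
Hypotheses (blk_refl : forall x, x \in blk x)
  (blk_eq : forall x y, x \in blk y -> blk x = blk y).

(** A block is determined by any of its points, so the block of the second family through a point of
    a block of the first is that same block. *)
Lemma cover_blocks_inj : {in powerset (blk @: T) &, injective (@cover T)}.
Proof.
suff sub E1 E2 : E1 \in powerset (blk @: T) -> E2 \in powerset (blk @: T) ->
    cover E1 = cover E2 -> E1 \subset E2.
  by move=> E1 E2 h1 h2 e; apply/eqP; rewrite eqEsubset !sub.
rewrite !inE => /subsetP h1 /subsetP h2 e; apply/subsetP => B BE.
have /imsetP[x _ Bx] := h1 _ BE.
have : x \in cover E2 by rewrite -e; apply/bigcupP; exists B; rewrite // Bx.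
case/bigcupP => B' B'E xB'; have /imsetP[y _ By] := h2 _ B'E.
by rewrite Bx (blk_eq (y := y)) -?By.
Qed.

Lemma saturated_cover (A : {set T}) : (forall x, x \in A -> blk x \subset A) ->
  cover [set B in blk @: T | B \subset A] = A.
Proof.
move=> sA; apply/setP => x; apply/bigcupP/idP => [[B]|xA].
  by rewrite inE => /andP[_ /subsetP BA] /BA.
by exists (blk x) => //; rewrite inE imset_f // sA.
Qed.

Lemma cover_saturated (E : {set {set T}}) x : E \subset blk @: T ->
  x \in cover E -> blk x \subset cover E.
Proof.
move=> /subsetP EK /bigcupP[B BE xB]; have /imsetP[y _ By] := EK _ BE.
by apply/subsetP => z zx; apply/bigcupP; exists B; rewrite // By -(blk_eq (x := x)) -?By.
Qed.

Lemma card_saturated :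
  #|[set A : {set T} | [forall x in A, blk x \subset A]]| = 2 ^ #|blk @: T|.
Proof.
rewrite -card_powerset -(card_in_imset cover_blocks_inj); apply: eq_card => A.
rewrite inE; apply/forall_inP/imsetP => [sA|[E]].
  exists [set B in blk @: T | B \subset A]; last by rewrite saturated_cover.
  by rewrite inE; apply/subsetP => B; rewrite inE => /andP[].
by rewrite inE => EK -> x; apply: cover_saturated.
Qed.

Lemma trivIset_blocks (E : {set {set T}}) : E \subset blk @: T -> trivIset E.
Proof.
move=> /subsetP EK; apply/trivIsetP => A B /EK/imsetP[x _ ->] /EK/imsetP[y _ ->].
apply: contraNT => /pred0Pn[z /andP[/= zx zy]].
by rewrite -(blk_eq zx) -(blk_eq zy).
Qed.

End Saturated.

Lemma mulI_negm N (i : 'I_N) : mulI N.-1 i = negm N i :> nat.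
Proof.
have N0 : 0 < N by apply: leq_ltn_trans (ltn_ord i).
rewrite val_mulI /negm; apply/eqP; rewrite -(eqn_modDr i) -mulnSr prednK // modnMl.
by rewrite -modnDmr subnK ?modnn // ltnW // ltn_mod.
Qed.

Lemma negmE N t : 0 < N -> negm N t = t * N.-1 %[mod N].
Proof.
move=> N0; rewrite /negm modn_mod; apply/eqP.
rewrite -(eqn_modDr t) -mulnSr prednK // modnMl.
by rewrite -modnDmr subnK ?modnn // ltnW // ltn_mod.
Qed.

Section Cosets.
Variables (N q : nat).
Hypotheses (N_gt0 : 0 < N) (coqN : coprime q N).
Implicit Types (i x y : 'I_N) (t : nat) (T : {set 'I_N}).

Lemma expn_addM_totient k j : q ^ (k + j * totient N) = q ^ k %[mod N].
Proof.
rewrite expnD (mulnC j) expnM -modnMmr -modnXm Euler_exp_totient // modnXm exp1n.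
by rewrite modnMmr muln1.
Qed.

(** Exponents of [q] only matter modulo [totient N], which is at most [N], so the bound on [j] in
    [cyc_coset] loses nothing. *)
Lemma mem_cyc_coset i t :
  reflect (exists j, i = t * q ^ j %[mod N]) (i \in cyc_coset N q t).
Proof.
rewrite inE; apply: (iffP existsP) => [[j /eqP ->]|[j]].
  by exists j; rewrite modn_mod.
rewrite modn_small // => ->.
have jN : j %% totient N < N.
  by rewrite (leq_trans _ (totient_leq N)) // ltn_mod totient_gt0.
exists (Ordinal jN); apply/eqP => /=.
by rewrite {1}(divn_eq j (totient N)) addnC -modnMmr expn_addM_totient modnMmr.
Qed.

Lemma cyc_coset_eq t t' j : t = t' * q ^ j %[mod N] -> cyc_coset N q t = cyc_coset N q t'.
Proof.
move=> e; apply/setP => x; apply/mem_cyc_coset/mem_cyc_coset => -[k ->].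
  by exists (j + k); rewrite -modnMml e modnMml expnD mulnA.
(* By Euler's theorem, [j * (totient N).-1] more factors [q] undo the factor [q ^ j]. *)
exists (k + j * (totient N).-1).
rewrite -[in RHS]modnMml e modnMml -mulnA -expnD addnCA -mulnS prednK ?totient_gt0 //.
by rewrite -[in RHS]modnMmr expn_addM_totient modnMmr.
Qed.

Lemma cyc_coset_refl i : i \in cyc_coset N q i.
Proof. by apply/mem_cyc_coset; exists 0; rewrite muln1. Qed.

Lemma cyc_coset_mem_eq i t : i \in cyc_coset N q t -> cyc_coset N q i = cyc_coset N q t.
Proof. by case/mem_cyc_coset => j /cyc_coset_eq. Qed.

Lemma stable_cyc_coset t : mul_stable q (cyc_coset N q t).
Proof.
apply/mul_stableP => i /mem_cyc_coset[j e]; apply/mem_cyc_coset; exists j.+1.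
by rewrite val_mulI modn_mod -modnMml e modnMml expnSr mulnA.
Qed.

Lemma stable_cosetP T :
  reflect (forall x, x \in T -> cyc_coset N q x \subset T) (mul_stable q T).
Proof.
apply: (iffP (mul_stableP q T)) => sT x xT; last first.
  apply: (subsetP (sT x xT)); apply/mem_cyc_coset; exists 1.
  by rewrite val_mulI modn_mod expn1.
apply/subsetP => y /mem_cyc_coset[j]; elim: j y => [|j IH] y e.
  suff -> : y = x by [].
  by apply: val_inj => /=; move: e; rewrite muln1 !modn_small.
have zN : (x * q ^ j) %% N < N by rewrite ltn_mod.
have -> : y = mulI q (Ordinal zN); last by apply/sT/IH; rewrite /= modn_mod.
by apply: val_inj; rewrite /= val_mulI modnMml -mulnA -expnSr -e modn_small.
Qed.

Lemma cover_cosets_saturated (e : pred {set 'I_N}) x :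
  x \in cover [set C in cyc_cosets N q | e C] ->
  cyc_coset N q x \subset cover [set C in cyc_cosets N q | e C].
Proof.
apply: (cover_saturated (blk := fun y : 'I_N => cyc_coset N q y)) => [y z|].
  exact: cyc_coset_mem_eq.
by apply/subsetP => C; rewrite inE => /andP[].
Qed.

(** The orbit of [t] under the group generated by [q] and -1 modulo [N]. *)
Definition sym_coset t : {set 'I_N} := cyc_coset N q t :|: cyc_coset N q (negm N t).

Lemma cyc_coset_negm t t' j : t = t' * q ^ j %[mod N] ->
  cyc_coset N q (negm N t) = cyc_coset N q (negm N t').
Proof.
move=> e; apply: (@cyc_coset_eq _ _ j).
by rewrite negmE // -modnMml e modnMml mulnAC -modnMml -negmE // modnMml.
Qed.

Lemma negmK t : negm N (negm N t) = t %[mod N].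
Proof.
rewrite negmE // -modnMml negmE // modnMml; apply/eqP.
rewrite -(eqn_modDr (t * N.-1)) -mulnSr prednK // modnMl.
by rewrite addnC -mulnSr prednK // modnMl.
Qed.

Lemma sym_coset_eq x t : x \in sym_coset t -> sym_coset x = sym_coset t.
Proof.
rewrite inE => /orP[] /mem_cyc_coset[j e]; rewrite /sym_coset.
  by rewrite (cyc_coset_eq e) (cyc_coset_negm e).
rewrite (cyc_coset_eq e) (cyc_coset_negm e) setUC; congr (_ :|: _).
by apply: (@cyc_coset_eq _ _ 0); rewrite muln1 negmK.
Qed.

Lemma sym_coset_refl x : x \in sym_coset x.
Proof. by rewrite inE cyc_coset_refl. Qed.

Lemma mem_sym_cosetP x t : 
  reflect (exists (b : bool) j, x = t * N.-1 ^ b * q ^ j %[mod N]) (x \in sym_coset t).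
Proof.
apply: (iffP setUP) => [[]/mem_cyc_coset[j e]|[[] [j e]]].
- by exists false, j; rewrite muln1.
- by exists true, j; rewrite expn1 e -modnMml negmE // modnMml.
- by right; apply/mem_cyc_coset; exists j; rewrite e expn1 -modnMml -negmE // modnMml.
- by left; apply/mem_cyc_coset; exists j; rewrite e muln1.
Qed.

Lemma mem_stables T :
  reflect (forall x, x \in T -> sym_coset x \subset T) (T \in stables q N).
Proof.
rewrite inE; apply: (iffP andP) => [[/stable_cosetP sq /mul_stableP sn] x xT|sT].
  rewrite subUset sq //=.
  by rewrite -mulI_negm sq // sn.
split; [apply/stable_cosetP|apply/mul_stableP] => x xT.
  by apply: subset_trans (sT x xT); rewrite subsetUl.
apply: (subsetP (sT x xT)); rewrite inE; apply/orP; right.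
by rewrite -mulI_negm cyc_coset_refl.
Qed.

Lemma card_stables : #|stables q N| = 2 ^ #|[set sym_coset x | x : 'I_N]|.
Proof.
rewrite -(card_saturated sym_coset_refl); last by move=> x y; apply: sym_coset_eq.
by apply: eq_card => T; rewrite [RHS]inE; apply/mem_stables/forall_inP.
Qed.

(** When -1 is a power of [q], each coset is its own opposite, so stability under [N.-1] follows
    from stability under [q]. *)
Lemma stables_opp_power : (exists j, N %| (q ^ j).+1) ->
  stables q N = [set T : {set 'I_N} | [forall x in T, cyc_coset N q x \subset T]].
Proof.
case=> j Nj; apply/setP => T; rewrite [RHS]inE.
apply/mem_stables/forall_inP => sT x xT.
  by apply: subset_trans (sT x xT); rewrite subsetUl.
rewrite subUset sT //=; suff -> : cyc_coset N q (negm N x) = cyc_coset N q x by apply: sT.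
apply: (@cyc_coset_eq _ _ j); rewrite negmE //; apply/eqP.
rewrite -(eqn_modDr x) -!mulnSr prednK // modnMl.
by rewrite eq_sym; apply: dvdn_mull.
Qed.

(** The map [h] below sends a coset to its union with the opposite coset; its fibres have two
    elements, except the fibre over the orbit of 0, which has one. *)
Lemma card_sym_cosets : (forall x, (x : nat) != 0 ->
    cyc_coset N q x != cyc_coset N q (negm N x)) ->
  #|cyc_cosets N q|.+1 = 2 * #|[set sym_coset x | x : 'I_N]|.
Proof.
move=> nopp; set O := [set sym_coset x | x : 'I_N].
pose z : 'I_N := Ordinal N_gt0.
pose h (C : {set 'I_N}) := \bigcup_(x in C) sym_coset x.
have hE x : h (cyc_coset N q x) = sym_coset x.
  apply/eqP; rewrite eqEsubset; apply/andP; split.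
    apply/bigcupsP => y yx; rewrite (_ : sym_coset y = sym_coset x) //.
    by apply: sym_coset_eq; rewrite inE yx.
  by apply: (bigcup_max x); first apply: cyc_coset_refl.
have zO : sym_coset z \in O by apply: imset_f.
have fibre x : [pred C | (C \in cyc_cosets N q) && (h C == sym_coset x)]
    =i [set cyc_coset N q x; cyc_coset N q (negm N x)].
  move=> C; rewrite !inE; apply/andP/orP => [[/imsetP[y _ ->]]|].
    rewrite hE => /eqP e; have := sym_coset_refl y; rewrite e inE.
    by case/orP => /cyc_coset_mem_eq ->; rewrite eqxx; [left|right].
  case=> /eqP->; first by rewrite hE eqxx imset_f.
  rewrite -mulI_negm imset_f // hE; split=> //; apply/eqP/sym_coset_eq.
  by rewrite inE orbC -mulI_negm cyc_coset_refl.
have -> : #|cyc_cosets N q| = \sum_(B in O) \sum_(C in cyc_cosets N q | h C == B) 1.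
  rewrite -sum1_card (partition_big h (fun B => B \in O)) //= => C /imsetP[x _ ->].
  by rewrite hE; apply: imset_f.
rewrite (bigD1 _ zO) /= sum1_card (eq_card (fibre z)).
have -> : cyc_coset N q (negm N z) = cyc_coset N q z.
  by congr cyc_coset; rewrite /negm mod0n subn0 modnn.
rewrite setUid cards1 (eq_bigr (fun=> 2)) => [|B /andP[/imsetP[x _ ->] xz]].
  rewrite (eq_bigl (mem (O :\ sym_coset z))) => [|B]; last by rewrite !inE andbC.
  by rewrite sum_nat_const (cardsD1 (sym_coset z) O) zO; lia.
rewrite sum1_card (eq_card (fibre x)) cards2 nopp //.
apply: contraNneq xz => x0; apply/eqP; congr sym_coset; exact: x0.
Qed.

End Cosets.

(** * Representatives of the pairs of opposite cosets *)

Section Representatives.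
Variables (l m q g : nat).
Hypotheses (l_pr : prime l) (l_odd : odd l) (m_gt0 : 0 < m) (coql : coprime q l).
Hypotheses (cogl : coprime g l) (g_gen : ord_mod (l ^ m) g = totient (l ^ m)).
Hypothesis f_odd : odd (ord_mod l q).

Local Notation N := (l ^ m).

Let l_gt0 : 0 < l. Proof. exact: prime_gt0. Qed.
Let N_gt0 : 0 < N. Proof. by rewrite expn_gt0 l_gt0. Qed.
Let coqN : coprime q N. Proof. exact: coprimeXr. Qed.
Let coN1 : coprime N.-1 l.
Proof. by have := coprimenS N.-1; rewrite prednK // coprime_pexpr. Qed.

Definition rep r k := l ^ (m - r) * g ^ k.

(** Equality would make [N] divide [t (q ^ j + 1)] for some [j]; the second factor is prime to [l]
    as the order of [q] is odd, so [N] would divide [t]. *)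
Lemma cyc_coset_opp_neq (t : nat) : ~~ (N %| t) ->
  cyc_coset N q t != cyc_coset N q (negm N t).
Proof.
apply: contraNneq => e.
have tN : t %% N < N by rewrite ltn_mod.
have : Ordinal tN \in cyc_coset N q (negm N t).
  by rewrite -e; apply/mem_cyc_coset => //; exists 0; rewrite /= modn_mod muln1.
case/(mem_cyc_coset N_gt0 coqN) => j /eqP /=.
rewrite modn_mod -modnMml negmE // modnMml -(eqn_modDl (t * q ^ j)) => h.
have : N %| t * (q ^ j).+1.
  rewrite mulnS addnC /dvdn (eqP h) mulnAC -mulnS prednK //.
  by rewrite modnMl.
by rewrite Gauss_dvdl // coprime_sym coprimeXr // odd_ord_not_opp.
Qed.

(** The numbers [g], [q] and [N.-1] are prime to [l], so the gcd is constant on the orbit; it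
    recovers the level [r] from any member. *)
Lemma gcd_sym_coset r k (x : 'I_N) : 0 < r <= m -> x \in sym_coset N q (rep r k) ->
  gcdn x N = l ^ (m - r).
Proof.
case/andP=> r0 rm /(mem_sym_cosetP N_gt0 coqN)[b [j e]].
rewrite -gcdn_modl e gcdn_modl /rep -{3}(subnK rm) expnD -!mulnA -muln_gcdr.
suff /eqP -> : gcdn (g ^ k * (N.-1 ^ b * q ^ j)) (l ^ r) == 1 by rewrite muln1.
by rewrite -/(coprime _ _) coprimeXr // !coprimeMl !coprimeXl.
Qed.

Lemma rep_ndvd r k : 0 < r <= m -> ~~ (N %| rep r k).
Proof.
case/andP=> r0 rm; rewrite /rep -{1}(subnK rm) expnD dvdn_pmul2l ?expn_gt0 ?l_gt0 //.
rewrite -(prednK r0) expnS; apply/negP => /(dvdn_trans (dvdn_mulr _ (dvdnn l))).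
by rewrite Euclid_dvdX // => /andP[lg _]; move: cogl; rewrite coprime_sym prime_coprime // lg.
Qed.

Lemma sym_coset_neq0 r k (x : 'I_N) : 0 < r <= m -> x \in sym_coset N q (rep r k) ->
  (x : nat) != 0.
Proof.
move=> rb xr; have := gcd_sym_coset rb xr; apply: contra_eq_neq => ->.
case/andP: rb => r0 rm; rewrite gcd0n eqn_exp2l ?prime_gt1 //.
by rewrite neq_ltn orbC -subn_gt0 subKn ?r0.
Qed.

Lemma mulX_log M c w b j i : q = g ^ c %[mod M] -> N.-1 = g ^ w %[mod M] ->
  i * N.-1 ^ b * q ^ j = i * g ^ (w * b + c * j) %[mod M].
Proof.
move=> qc Nw.
have eN : N.-1 ^ b = g ^ (w * b) %[mod M] by rewrite -modnXm Nw modnXm expnM.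
have eq : q ^ j = g ^ (c * j) %[mod M] by rewrite -modnXm qc modnXm expnM.
by rewrite -mulnA -modnMmr -(modnMm (N.-1 ^ b)) eN eq modnMm modnMmr -expnD.
Qed.

(** The gcd with [N] determines the level. Division by [l ^ (m - r)] leaves a congruence between
    logarithms modulo [totient (l ^ r)]; half of [delta l q r] divides this modulus and the
    logarithms of [q] and -1, so [k] and [k'] agree modulo a number that exceeds both. *)
Lemma rep_unique r k r' k' (x : 'I_N) : 0 < r <= m -> 0 < r' <= m ->
  k < (delta l q r)./2 -> k' < (delta l q r')./2 ->
  x \in sym_coset N q (rep r k) -> x \in sym_coset N q (rep r' k') -> (r, k) = (r', k').
Proof.
move=> rb rb' kd kd' xr xr'.
have rr : r = r'.
  have := gcd_sym_coset rb xr; rewrite (gcd_sym_coset rb' xr') => /eqP.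
  by rewrite eqn_exp2l ?prime_gt1 // => /eqP; lia.
subst r'; congr (_, _).
have [c [w [qc Nw _ dc [d0 dphi _ [y wy _]]]]] :=
  gen_logs l_pr l_odd coql m_gt0 cogl g_gen rb f_odd.
case/andP: (rb) => r0 rm.
case/(mem_sym_cosetP N_gt0 coqN): xr => b [j e].
case/(mem_sym_cosetP N_gt0 coqN): xr' => b' [j' ]; rewrite e /rep -!mulnA.
have -> : N = l ^ (m - r) * l ^ r by rewrite -expnD subnK.
rewrite -!muln_modr => /eqP; rewrite eqn_pmul2l ?expn_gt0 ?l_gt0 //.
rewrite !mulnA => /eqP; rewrite -expnD subnK // !(mulX_log _ _ _ qc Nw) -!expnD => /eqP.
rewrite (gen_log l_pr m_gt0 cogl g_gen) // => h.
have : k + (w * b + c * j) == k' + (w * b' + c * j') %[mod (delta l q r)./2].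
  by rewrite -(modn_dvdm _ dphi) (eqP h) modn_dvdm.
have dvd b1 j1 : (delta l q r)./2 %| w * b1 + c * j1.
  by rewrite dvdn_add // dvdn_mulr // wy dvdn_mulr.
have /dvdnP[z ->] := dvd b j; have /dvdnP[z' ->] := dvd b' j'.
by rewrite ![_ + _ * _]addnC !modnMDl !modn_small // => /eqP.
Qed.

(** With [v] the [l]-adic valuation of [x], the level is [m - v]. Let [j] be the logarithm of the
    cofactor [u]: then [k] is [j %% d], and the remaining multiple of [d] is absorbed by a power of
    [q], together with -1 when [j %/ d] is odd. *)
Lemma rep_exists (x : 'I_N) : (x : nat) != 0 ->
  exists r k, [/\ 0 < r <= m, k < (delta l q r)./2 & x \in sym_coset N q (rep r k)].
Proof.
rewrite -lt0n => x0; have [u lu xE] := pfactor_coprime l_pr x0.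
have vm : logn l x < m.
  rewrite -(ltn_exp2l _ _ (prime_gt1 l_pr)); apply: leq_ltn_trans (ltn_ord x).
  by rewrite dvdn_leq // {2}xE dvdn_mull.
set v := logn l x in xE vm; pose r := m - v.
have rb : 0 < r <= m by rewrite /r subn_gt0 vm leq_subr.
have mr : m - r = v by rewrite /r subKn // ltnW.
have [c [w [qc Nw cz dc [d0 dphi w2 [y wy yo]]]]] :=
  gen_logs l_pr l_odd coql m_gt0 cogl g_gen rb f_odd.
set d := (delta l q r)./2 in cz dc d0 dphi wy.
have [j uj] := gen_surj l_pr m_gt0 cogl g_gen rb (etrans (coprime_sym u l) lu).
have [b [t jE]] : exists (b : bool) t,
    j = j %% d + (w * b + c * t) %[mod totient (l ^ r)].
  have [jo|je] := boolP (odd (j %/ d)).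
    (* Here [c * t] is congruent to [(j %/ d) * d + w], and the second [w] cancels the first because
       [totient (l ^ r)] divides [2 w]. *)
    have [t et] := cz (j %/ d + y)./2.
    exists true, t; rewrite muln1 addnA -modnDmr -et modnDmr.
    rewrite -doubleMr doubleMl even_halfK ?oddD ?jo ?yo // mulnDl (mulnC y) -wy.
    by rewrite addnACA addnn addnC (addnC (_ %% _)) -divn_eq -modnDml (eqP w2).
  have [t et] := cz (j %/ d)./2.
  exists false, t; rewrite muln0 add0n -modnDmr -et modnDmr.
  by rewrite -doubleMr doubleMl even_halfK // {1}(divn_eq j d) addnC.
exists r, (j %% d); split=> //; first by rewrite ltn_mod.
apply/mem_sym_cosetP => //; exists b, t; rewrite xE /rep mr mulnC -!mulnA.
have -> : N = l ^ v * l ^ r by rewrite -expnD /r subnKC // ltnW.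
rewrite -!muln_modr; congr (_ * _); rewrite -expnD /r subnKC 1?ltnW // -/r.
rewrite mulnA (mulX_log _ _ _ qc Nw) -expnD uj; apply/eqP.
by rewrite (gen_log l_pr m_gt0 cogl g_gen) //; apply/eqP.
Qed.

End Representatives.

Import GRing.Theory.
Local Open Scope ring_scope.

(** * Cyclic codes and their duals *)

Section CompPoly.
Variable R : fieldType.
Implicit Types f g : {poly R}.

Lemma dvdp_comp_sub f g h : g - h %| (f \Po g) - (f \Po h).
Proof.
elim/poly_ind: f => [|f c IH]; first by rewrite !comp_poly0 subrr dvdp0.
rewrite !comp_polyD !comp_polyM !comp_polyX !comp_polyC opprD addrACA subrr addr0.
have -> : (f \Po g) * g - (f \Po h) * h
   = ((f \Po g) - (f \Po h)) * g + (f \Po h) * (g - h) by rewrite mulrBl mulrBr subrKA.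
by apply: dvdp_add; [apply: dvdp_mulr | apply: dvdp_mull].
Qed.

Lemma dvdp_comp f g h : f %| g -> f \Po h %| g \Po h.
Proof. by case/Pdiv.Field.dvdpP=> k ->; rewrite comp_polyM dvdp_mull. Qed.

End CompPoly.

Section CyclicCodes.
Variables (F : finFieldType) (N : nat).
Hypothesis N_gt0 : (0 < N)%N.
Implicit Types (f g : {poly F}) (u v : 'rV[F]_N) (C : {set 'rV[F]_N}).

Let Q : {poly F} := 'X^N - 1.

Lemma size_Xn_sub1 : size Q = N.+1. Proof. exact: size_Xn_sub_1. Qed.

Lemma monic_Xn_sub1 : Q \is monic. Proof. exact: monicXnsubC. Qed.

Lemma Xn_sub1_neq0 : Q != 0. Proof. exact: monic_neq0 monic_Xn_sub1. Qed.

Definition red f : 'rV[F]_N := poly_rV (f %% Q).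

Lemma rVpoly_red f : rVpoly (red f) = f %% Q.
Proof. by rewrite poly_rV_K // -ltnS -size_Xn_sub1 ltn_modp Xn_sub1_neq0. Qed.

Lemma size_rVpoly_lt v : (size (rVpoly v) < size Q)%N.
Proof. by rewrite size_Xn_sub1 ltnS size_poly. Qed.

Lemma rVpolyK_red v : red (rVpoly v) = v.
Proof. by rewrite /red modp_small ?rVpolyK ?size_rVpoly_lt. Qed.

Lemma redD f g : red (f + g) = red f + red g.
Proof. by rewrite /red modpD linearD. Qed.

Lemma mulR_red f g : mulR (red f) (red g) = red (f * g).
Proof. by rewrite /mulR !rVpoly_red /red modp_mul mulrC modp_mul mulrC. Qed.

Lemma red_eq0 f : (red f == 0) = (Q %| f).
Proof.
apply/eqP/idP => [e|/modp_eq0P e]; last by rewrite /red e linear0.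
by apply/modp_eq0P; rewrite -rVpoly_red e linear0.
Qed.

Lemma dvdp_red g f : g %| Q -> (g %| rVpoly (red f)) = (g %| f).
Proof. by move=> gQ; rewrite rVpoly_red -dvdp_mod. Qed.

Lemma dvdQ_rVpoly v : (Q %| rVpoly v) = (v == 0).
Proof. by rewrite -red_eq0 rVpolyK_red. Qed.

Lemma mem_gen_code g v : g %| Q -> (v \in gen_code N g) = (g %| rVpoly v).
Proof.
move=> gQ; apply/imsetP/idP => [[a _ ->]|/Pdiv.Field.dvdpP[k kg]].
  by rewrite -[a]rVpolyK_red mulR_red dvdp_red // dvdp_mull.
by exists (red k) => //; rewrite mulR_red -kg rVpolyK_red.
Qed.

Lemma gen_code_inj g1 g2 : g1 \is monic -> g2 \is monic -> g1 %| Q -> g2 %| Q ->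
  gen_code N g1 = gen_code N g2 -> g1 = g2.
Proof.
move=> m1 m2 d1 d2 e; apply/eqP; rewrite -eqp_monic //; apply/andP; split.
  by rewrite -(dvdp_red _ d1) -mem_gen_code // e mem_gen_code // dvdp_red.
by rewrite -(dvdp_red _ d2) -mem_gen_code // -e mem_gen_code // dvdp_red.
Qed.

Lemma gen_code_cyclic g : g %| Q -> is_cyclic_code (gen_code N g).
Proof.
move=> gQ; apply/and3P; split.
- by rewrite mem_gen_code // linear0 dvdp0.
- apply/forall_inP => u; rewrite mem_gen_code // => gu.
  apply/forall_inP => v; rewrite mem_gen_code // => gv.
  by rewrite mem_gen_code // linearD dvdp_add.
- apply/forallP => a; apply/forall_inP => v; rewrite !mem_gen_code // => gv.
  by rewrite -[a]rVpolyK_red -[v]rVpolyK_red mulR_red dvdp_red // dvdp_mull.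
Qed.

Lemma cyclic_code_gen C : is_cyclic_code C ->
  exists g, [/\ g \is monic, g %| Q & C = gen_code N g].
Proof.
case/and3P => C0 /forall_inP CD /forallP CM.
have CMr f g : red g \in C -> red (f * g) \in C.
  by move=> gC; rewrite -mulR_red; move/forall_inP: (CM (red f)); apply.
have CDr f g : red f \in C -> red g \in C -> red (f + g) \in C.
  by move=> fC gC; rewrite redD; move/forall_inP: (CD _ fC); apply.
(* The generator is the gcd of [Q] and of all codewords. *)
have [g [gQ gC gdv]] : exists g, [/\ g %| Q, red g \in C
    & forall v, v \in enum C -> g %| rVpoly v].
  have : {subset enum C <= C} by move=> v; rewrite mem_enum.
  elim: (enum C) => [|c s IH] sC.
    by exists Q; split=> //; have /eqP-> : red Q == 0 by rewrite red_eq0.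
  case: IH => [v vs|g [gQ gC gdv]]; first by apply: sC; rewrite inE vs orbT.
  have [[a b] /eqpP[[x y] /andP[x0 y0] e]] := Bezoutp g (rVpoly c).
  exists (gcdp g (rVpoly c)); split.
  - exact: dvdp_trans (dvdp_gcdl _ _) gQ.
  - have -> : gcdp g (rVpoly c) = (y^-1 *: (x *: a)) * g + (y^-1 *: (x *: b)) * rVpoly c.
      by rewrite -!scalerAl -scalerDr -scalerDr e scalerA mulVf ?scale1r.
    by apply: CDr; apply: CMr; rewrite ?rVpolyK_red // sC // inE eqxx.
  - move=> v; rewrite inE => /orP[/eqP->|/gdv]; first exact: dvdp_gcdr.
    exact: dvdp_trans (dvdp_gcdl _ _).
have g0 : g != 0 by apply: contraTneq gQ => ->; rewrite dvd0p Xn_sub1_neq0.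
pose g' := (lead_coef g)^-1 *: g.
have gg' : g' %= g by rewrite eqp_scale ?invr_eq0 ?lead_coef_eq0.
have g'Q : g' %| Q by rewrite (eqp_dvdl _ gg').
exists g'; split => //; first by rewrite monicE lead_coefZ mulVf ?lead_coef_eq0.
apply/setP => v; rewrite mem_gen_code // (eqp_dvdl _ gg').
apply/idP/idP => [vC|/Pdiv.Field.dvdpP[k e]]; first by rewrite gdv ?mem_enum.
by rewrite -[v]rVpolyK_red e CMr.
Qed.

(* [conjp] is the substitution [X |-> X^-1] modulo [X^N - 1]. *)
Definition conjp f : {poly F} := f \Po 'X^(N.-1).

Lemma conjpM f g : conjp (f * g) = conjp f * conjp g.
Proof. exact: comp_polyM. Qed.

Lemma dvdp_conjp f g : f %| g -> conjp f %| conjp g.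
Proof. exact: dvdp_comp. Qed.

Lemma Xn_modp k : 'X^k %% Q = 'X^(k %% N).
Proof.
rewrite {1}(divn_eq k N) exprD mulnC exprM.
have -> : 'X^N ^+ (k %/ N) * 'X^(k %% N)
  = ('X^N ^+ (k %/ N) - 1) * 'X^(k %% N) + 'X^(k %% N) :> {poly F}.
  by rewrite mulrBl mul1r subrK.
rewrite modpD [X in _ + X]modp_small; last by rewrite size_Xn_sub1 size_polyXn ltnS ltn_mod.
by rewrite subrX1 -mulrA mulrC modp_mull add0r.
Qed.

Lemma Xn_dvd_sub i j : (i == j %[mod N])%N -> Q %| 'X^i - 'X^j.
Proof.
by move=> /eqP ij; apply/modp_eq0P; rewrite modpD modpN !Xn_modp ij subrr.
Qed.

Lemma dvdQ_conjp_Q : Q %| conjp Q.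
Proof.
have -> : conjp Q = 'X^(N.-1 * N) - 'X^0.
  by rewrite /conjp comp_polyB comp_Xn_poly -exprM -polyC1 comp_polyC.
by apply: Xn_dvd_sub; rewrite modnMl mod0n.
Qed.

Lemma conjpK f : Q %| conjp (conjp f) - f.
Proof.
rewrite /conjp -comp_polyA comp_Xn_poly -exprM -{2}(comp_polyXr f).
apply: dvdp_trans (dvdp_comp_sub _ _ _).
rewrite -{2}(expr1 'X); apply: Xn_dvd_sub; apply/eqP.
(* For [N = k + 2] the reason is [(N - 1) ^ 2 = k N + 1]; for [N = 1] the modulus is trivial. *)
case: N N_gt0 => //= -[|k] _; first by rewrite !modn1.
have -> : (k.+1 * k.+1 = k * k.+2 + 1)%N by lia.
by rewrite modnMDl.
Qed.

Lemma dvdp_conjpK g f : g %| Q -> (g %| conjp (conjp f)) = (g %| f).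
Proof.
by move=> gQ; rewrite -[conjp _](subrK f) dvdp_addr // (dvdp_trans gQ) ?conjpK.
Qed.

Lemma dvdQ_conjp f : Q %| f -> Q %| conjp f.
Proof. by move=> /dvdp_conjp; apply: dvdp_trans dvdQ_conjp_Q. Qed.

Lemma dvdQ_conjpE f : (Q %| conjp f) = (Q %| f).
Proof.
by apply/idP/idP => [/dvdQ_conjp|/dvdQ_conjp //]; rewrite dvdp_conjpK.
Qed.

(* [tau (u * conjp v)] is the Euclidean product of [u] and [v]. *)
Let tau f : F := (f %% Q)`_0.

Let tauD f g : tau (f + g) = tau f + tau g.
Proof. by rewrite /tau modpD coefD. Qed.

Let tauZ a f : tau (a *: f) = a * tau f.
Proof. by rewrite /tau modpZl coefZ. Qed.

Let tau_sum (I : Type) (r : seq I) (G : I -> {poly F}) :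
  tau (\sum_(i <- r) G i) = \sum_(i <- r) tau (G i).
Proof.
elim/big_rec2: _ => [|i x y _ <-]; first by rewrite /tau mod0p coef0.
by rewrite tauD.
Qed.

Let tauXn k : tau 'X^k = (N %| k)%:R.
Proof. by rewrite /tau Xn_modp coefXn eq_sym. Qed.

Lemma rVpolyE v : rVpoly v = \sum_(i < N) v 0 i *: 'X^i.
Proof.
rewrite /rVpoly poly_def; apply: eq_bigr => i _.
by case: insubP => [j _ /val_inj->|]; rewrite ?ltn_ord.
Qed.

Lemma tau_conjp u v : tau (rVpoly u * conjp (rVpoly v)) = \sum_(i < N) v 0 i * u 0 i.
Proof.
rewrite !rVpolyE /conjp linear_sum mulr_suml tau_sum.
apply: eq_bigr => i _; rewrite mulr_sumr tau_sum (bigD1 i) //= big1 => [|j ji].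
  rewrite comp_polyZ -scalerAl -scalerAr !tauZ comp_Xn_poly -exprM -exprD tauXn.
  by rewrite -mulSn prednK // dvdn_mulr // mulr1 addr0 mulrC.
rewrite comp_polyZ -scalerAl -scalerAr !tauZ comp_Xn_poly -exprM -exprD tauXn.
have -> : (N %| i + N.-1 * j)%N = false; last by rewrite !mulr0.
apply: contraNF ji => h; rewrite -val_eqE /= eq_sym.
suff : (i == j %[mod N])%N by rewrite !modn_small.
by rewrite -(eqn_modDr (N.-1 * j)) -mulSn prednK // modnMr; apply: h.
Qed.

(** Multiplication by ['X^(N - j)] is a cyclic shift that brings coefficient [j] to place 0, the one
    that [tau] reads. *)
Lemma tau_shift v (j : 'I_N) : tau ('X^(N - j) * rVpoly v) = v 0 j.
Proof.
rewrite rVpolyE mulr_sumr tau_sum (bigD1 j) //= big1 => [|i ij].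
  by rewrite -scalerAr tauZ -exprD subnK ?(ltnW (ltn_ord j)) // tauXn dvdnn mulr1 addr0.
rewrite -scalerAr tauZ -exprD tauXn.
have -> : (N %| N - j + i)%N = false; last by rewrite mulr0.
apply: contraNF ij => d; rewrite -val_eqE /=.
suff : (i == j %[mod N])%N by rewrite !modn_small.
by rewrite -(eqn_modDl (N - j)) subnK ?modnn ?(ltnW (ltn_ord j)); first apply: d.
Qed.

(** A cyclic code is closed under shifts, so orthogonality to it kills every coefficient of
    [g * conjp (rVpoly v)] modulo [Q], not just the constant one. *)
Lemma mem_dual_gen_code g v : g %| Q ->
  (v \in dual_code (gen_code N g)) = (Q %| g * conjp (rVpoly v)).
Proof.
move=> gQ.
have dotE c : (v *m c^T == 0) = (tau (rVpoly c * conjp (rVpoly v)) == 0).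
  rewrite tau_conjp; apply/eqP/eqP => [/matrixP/(_ 0 0)|e].
    by rewrite !mxE => e; rewrite -[RHS]e; apply: eq_bigr => i _; rewrite mxE.
  apply/matrixP => i j; rewrite !ord1 !mxE -[RHS]e.
  by apply: eq_bigr => k _; rewrite mxE.
rewrite inE; apply/forall_inP/idP => [h|h c].
  set f := g * _; rewrite -red_eq0; apply/eqP/rowP => j.
  have := h (red ('X^(N - j) * g)); rewrite mem_gen_code // dvdp_red // dvdp_mull // dotE.
  move=> /(_ isT)/eqP e; rewrite [RHS]mxE -[LHS]tau_shift -[RHS]e /tau !rVpoly_red.
  by rewrite modp_mul (mulrC (_ %% Q)) modp_mul /f mulrA mulrC.
rewrite mem_gen_code // dotE => /Pdiv.Field.dvdpP[k ->].
by rewrite -mulrA /tau; have /modp_eq0P -> := dvdp_mull k h; rewrite coef0.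
Qed.

(** From right to left, a word [f] of the intersection has [conjp f] divisible by the coprime
    factors [g] and [Q %/ g], hence by [Q]. From left to right, two multiples of [g] are tested
    against the trivial intersection. *)
Lemma LCD_gen_codeP g : g %| Q ->
  is_LCD (gen_code N g) = (g %| conjp g) && coprimep g (Q %/ g).
Proof.
move=> gQ; set h := Q %/ g.
have hg : h * g = Q by rewrite divpK.
have conj_swap f : (Q %| g * conjp f) = (Q %| conjp g * f).
  rewrite -dvdQ_conjpE conjpM -[conjp (conjp f)](subrK f) mulrDr dvdp_addr //.
  by rewrite dvdp_mull ?conjpK.
have interE v : (v \in gen_code N g :&: dual_code (gen_code N g))
    = (g %| rVpoly v) && (Q %| conjp g * rVpoly v).
  by rewrite inE mem_gen_code // mem_dual_gen_code // conj_swap.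
have LCDP : reflect (forall f, g %| f -> Q %| conjp g * f -> Q %| f)
    (is_LCD (gen_code N g)).
  apply: (iffP eqP) => [e f gf qf|H].
    rewrite -red_eq0 -in_set1 -e interE dvdp_red // gf.
    by rewrite rVpoly_red; apply/modp_eq0P; rewrite modp_mul; apply/modp_eq0P.
  apply/setP => v; rewrite interE in_set1 -dvdQ_rVpoly.
  apply/andP/idP => [[]|qv]; first exact: H.
  by split; [apply: dvdp_trans qv | apply: dvdp_mull].
have g0 : g != 0 by apply: contraTneq gQ => ->; rewrite dvd0p Xn_sub1_neq0.
have h0 : h != 0 by apply: contraNneq Xn_sub1_neq0 => e; rewrite -hg e mul0r.
apply/LCDP/andP => [H|[gc cop] f gf]; last first.
  rewrite -conj_swap -{1}hg (mulrC g) dvdp_mul2r // => hf.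
  rewrite -dvdQ_conjpE -hg Gauss_dvdp 1?coprimep_sym // hf.
  exact: dvdp_trans gc (dvdp_conjp gf).
have gg : g %| conjp g.
  (* The first test word [(Q %/ g') * g] has a product with [conjp g] divisible by [Q], which yields
     [g' %| g]. Conjugating a Bezout relation for [g'] then gives [g %| conjp g']. *)
  set g' := gcdp Q (conjp g).
  have g'g : g' %| g.
    have g'Q : g' %| Q by exact: dvdp_gcdl.
    have h'0 : Q %/ g' != 0.
      by apply: contraNneq Xn_sub1_neq0 => e; rewrite -/Q -(divpK g'Q) e mul0r.
    rewrite -(dvdp_mul2l _ _ h'0) divpK //; apply: H; first exact: dvdp_mull.
    rewrite mulrCA mulrA -{1}(divpK g'Q) dvdp_mulr // dvdp_mul2l //; exact: dvdp_gcdr.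
  apply: dvdp_trans (dvdp_conjp g'g).
  have [[a b] /= /andP[ab _]] := Bezoutp Q (conjp g).
  apply: dvdp_trans (dvdp_conjp ab); rewrite /conjp comp_polyD -!/(conjp _) !conjpM.
  rewrite dvdp_add // dvdp_mull //; first exact: dvdp_trans gQ dvdQ_conjp_Q.
  by rewrite dvdp_conjpK.
split=> //; set d := gcdp g h.
have dh : d %| h := dvdp_gcdr _ _.
(* The second test word: [d] divides [g], which divides [conjp g], so its product with [conjp g] is
   a multiple of [d * (h %/ d) * g = Q]. Then [h] divides [h %/ d], and [d] is constant. *)
have : Q %| (h %/ d) * g.
  apply: H; first exact: dvdp_mull.
  have [k ->] := Pdiv.Field.dvdpP _ _ gg; rewrite -mulrA dvdp_mull //.
  have [k' gd] := Pdiv.Field.dvdpP _ _ (dvdp_gcdl g h : d %| g).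
  by rewrite {1}gd -mulrA (mulrA d) (mulrC d) divpK // hg dvdp_mull.
rewrite -{1}hg dvdp_mul2r // => /Pdiv.Field.dvdpP[k e].
rewrite /coprimep -dvdp1; apply/Pdiv.Field.dvdpP; exists k.
have hd0 : h %/ d != 0 by apply: contraNneq h0 => e0; rewrite -(divpK dh) e0 mul0r.
by apply: (mulIf hd0); rewrite mul1r -mulrA (mulrC d) divpK.
Qed.

Lemma LCD_cyclicP C : is_LCD_cyclic C <->
  exists g, [/\ g \is monic, g %| Q, g %| conjp g, coprimep g (Q %/ g) & C = gen_code N g].
Proof.
split=> [/andP[/cyclic_code_gen[g [mg gQ ->]]]|[g [mg gQ gg cg ->]]].
  by rewrite LCD_gen_codeP // => /andP[]; exists g.
by rewrite /is_LCD_cyclic gen_code_cyclic // LCD_gen_codeP // gg.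
Qed.

End CyclicCodes.

(** * LCD codes and sets of roots *)

Section LinearFactors.
Variable L : fieldType.
Implicit Types (f g h : {poly L}) (rs : seq L).

Lemma coprimep_prod_XsubC rs f :
  coprimep (\prod_(x <- rs) ('X - x%:P)) f = all (fun x => ~~ root f x) rs.
Proof.
elim: rs => [|x rs IH] /=; first by rewrite big_nil coprime1p.
by rewrite big_cons coprimepMl IH coprimep_sym coprimep_XsubC.
Qed.

(** A root of [g] is not a root of [h]. So the linear factors at roots of [g], being coprime to [h],
    divide [g] with their full power, the others divide [h], and cancelling leaves nothing else in
    [g]. *)
Lemma coprime_factor_prod_XsubC rs P g h : (0 < P)%N -> g \is monic -> coprimep g h ->
  g * h = (\prod_(x <- rs) ('X - x%:P)) ^+ P ->
  g = (\prod_(x <- rs | root g x) ('X - x%:P)) ^+ P.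
Proof.
move=> P0 mg cgh e.
have e' : g * h = (\prod_(x <- [seq x <- rs | root g x]) ('X - x%:P)) ^+ P
    * (\prod_(x <- [seq x <- rs | ~~ root g x]) ('X - x%:P)) ^+ P.
  by rewrite e -exprMn !big_filter (bigID (root g)).
rewrite -[in RHS]big_filter; move: e'; set U := \prod_(x <- _) _; set W := \prod_(x <- _) _.
move=> e'.
have Ug : U ^+ P %| g.
  rewrite -(@Gauss_dvdpl _ g h) ?e' ?dvdp_mulr //.
  rewrite coprimep_pexpl // coprimep_prod_XsubC; apply/allP => x.
  by rewrite mem_filter => /andP[gx _]; apply: coprimep_root cgh gx.
have Wh : W ^+ P %| h.
  rewrite -(@Gauss_dvdpr _ h g) ?e' ?dvdp_mull //.
  rewrite coprimep_pexpl // coprimep_prod_XsubC; apply/allP => x.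
  by rewrite mem_filter => /andP[].
have mU : U ^+ P \is monic by rewrite monic_exp // monic_prod_XsubC.
have mW : W ^+ P \is monic by rewrite monic_exp // monic_prod_XsubC.
apply/eqP; rewrite -eqp_monic // /eqp Ug andbT.
have [k hk] := Pdiv.Field.dvdpP _ _ Wh.
by rewrite -(dvdp_mul2r _ _ (monic_neq0 mW)) -e' hk mulrA mulrAC dvdp_mulr.
Qed.

End LinearFactors.

(** * Frobenius descent of polynomials to the finite subfield *)

Section Frobenius.
Variables (F : finFieldType) (L : fieldType) (iota : {rmorphism F -> L}).

Lemma pow_pchar_rmorphism p s : p \in [pchar L] ->
  exists phi : {rmorphism L -> L}, forall x, phi x = x ^+ (p ^ s).
Proof.
move=> cL; elim: s => [|s [phi phiE]]; first by exists idfun.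
by exists (phi \o pFrobenius_aut cL) => x; rewrite /= phiE pFrobenius_autE -exprM expnS.
Qed.

(** The polynomial ['X^#|F| - 'X] has at most [#|F|] roots, and the image of [F] supplies that
    many. *)
Lemma pow_card_fixed x : x ^+ #|F| = x -> exists a, x = iota a.
Proof.
move=> xq; have q1 : (1 < #|F|)%N := card_finNzRing_gt1 F.
have [/codomP[a ->]|xn] := boolP (x \in codom iota); first by exists a.
have sz : size ('X^#|F| - 'X : {poly L}) = #|F|.+1.
  by rewrite size_polyDl size_polyXn // size_polyN size_polyX.
suff : (size (x :: codom iota) < size ('X^#|F| - 'X : {poly L})%R)%N.
  by rewrite sz /= size_codom ltnn.
apply: max_poly_roots; first by rewrite -size_poly_gt0 sz.
  apply/allP => y; rewrite inE => /orP[/eqP->|/codomP[a ->]]; rewrite rootE !hornerE.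
    by rewrite xq subrr.
  by rewrite -rmorphXn expf_card subrr.
by rewrite /= xn map_inj_uniq ?enum_uniq //; apply: fmorph_inj.
Qed.

Lemma map_poly_descent (f : {poly L}) : (forall i, f`_i ^+ #|F| = f`_i) ->
  exists f0, map_poly iota f0 = f.
Proof.
(* The default 0 is never taken, since each coefficient comes from [F]. *)
move=> fx; pose a i := odflt 0 [pick a | iota a == f`_i].
have aE i : iota (a i) = f`_i.
  rewrite /a; case: pickP => [b /eqP //|none].
  by have [b e] := pow_card_fixed (fx i); have := none b; rewrite e eqxx.
exists (\poly_(i < size f) a i); apply/polyP => i.
rewrite coef_map coef_poly; case: ltnP => [_|le]; first exact: aE.
by rewrite [RHS]nth_default //; apply: rmorph0.
Qed.

End Frobenius.

(** * LCD generators and pairs of stable sets of exponents *)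

Section RootSets.
Variables (p q s n N : nat) (F : finFieldType) (L : fieldType)
  (iota : {rmorphism F -> L}) (eta : L).
Hypotheses (p_pr : prime p) (p_odd : odd p) (cardF : #|F| = q) (qE : q = (p ^ s)%N).
Hypotheses (N_odd : odd N) (coqN : coprime q N) (eta_prim : N.-primitive_root eta).

Local Notation P := (p ^ n)%N.
Local Notation len := (2 * N * P)%N.
Implicit Types T : {set 'I_N}.

Let N_gt0 : (0 < N)%N. Proof. exact: odd_gt0. Qed.
Let P_gt0 : (0 < P)%N. Proof. by rewrite expn_gt0 prime_gt0. Qed.
Let len_gt0 : (0 < len)%N. Proof. by rewrite !muln_gt0 N_gt0 P_gt0. Qed.

Let pcharF : p \in [pchar F].
Proof. by apply: (@card_finPcharP _ _ s) => //; rewrite cardF. Qed.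

Let pcharL : p \in [pchar L]. Proof. by rewrite (fmorph_pchar iota). Qed.

Let two_neq0 : 2%:R != 0 :> L.
Proof.
rewrite -(dvdn_pcharf pcharL); apply: contraTN p_odd.
by rewrite dvdn_prime2 // => /eqP->.
Qed.

(** Raised to the odd power [N], an equality would read [1 = -1]. *)
Lemma opp_exp_prim_root (i j : nat) : eta ^+ i != - eta ^+ j.
Proof.
apply/negP => /eqP /(congr1 (fun x => x ^+ N)); rewrite exprNn -!exprM.
rewrite mulnC exprM (mulnC j) exprM (prim_expr_order eta_prim) !expr1n mulr1.
rewrite -signr_odd N_odd expr1 => /eqP; rewrite -addr_eq0 -mulr2n.
exact/negP.
Qed.

Definition roots_of T1 T2 : seq L :=
  [seq eta ^+ i | i : 'I_N <- enum T1] ++ [seq - eta ^+ i | i : 'I_N <- enum T2].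

Let eta_inj : injective (fun i : 'I_N => eta ^+ i).
Proof.
by move=> i j /eqP; rewrite (eq_prim_root_expr eta_prim) !modn_small // => /eqP/val_inj.
Qed.

Lemma uniq_roots_of T1 T2 : uniq (roots_of T1 T2).
Proof.
rewrite cat_uniq !map_inj_uniq ?enum_uniq //=; last first.
  by move=> i j /oppr_inj /eta_inj.
rewrite andbT; apply/hasPn => x /mapP[j _ ->]; apply/mapP => -[i _ /esym/eqP].
by rewrite (negPf (opp_exp_prim_root _ _)).
Qed.

Lemma mem_roots_of T1 T2 (i : 'I_N) : (eta ^+ i \in roots_of T1 T2) = (i \in T1).
Proof.
rewrite mem_cat (mem_map eta_inj) mem_enum; case: (i \in T1) => //=.
by apply/mapP => -[j _ /eqP]; rewrite (negPf (opp_exp_prim_root _ _)).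
Qed.

Lemma mem_roots_ofN T1 T2 (i : 'I_N) : (- eta ^+ i \in roots_of T1 T2) = (i \in T2).
Proof.
have inj : injective (fun j : 'I_N => - eta ^+ j) by move=> j k /oppr_inj /eta_inj.
rewrite mem_cat orbC (mem_map inj) mem_enum.
case: (i \in T2) => //=.
by apply/mapP => -[j _ /esym/eqP]; rewrite (negPf (opp_exp_prim_root _ _)).
Qed.

Definition MpolyLN T : {poly L} := \prod_(i in T) ('X + (eta ^+ i)%:P).

Definition rootsp T1 T2 : {poly L} := MpolyL eta T1 * MpolyLN T2.

Lemma rootspE T1 T2 : rootsp T1 T2 = \prod_(x <- roots_of T1 T2) ('X - x%:P).
Proof.
rewrite /rootsp /roots_of big_cat !big_map !big_enum /=; congr (_ * _).
by apply: eq_bigr => i _; rewrite polyCN opprK.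
Qed.

Lemma rootspT : rootsp setT setT = 'X^(2 * N) - 1.
Proof.
have sz : size ('X^(2 * N) - 1 : {poly L}) = (2 * N).+1 by rewrite size_Xn_sub_1 // muln_gt0.
rewrite rootspE [RHS](@all_roots_prod_XsubC _ _ (roots_of setT setT)).
- by rewrite (monicP _) ?scale1r // monicXnsubC // muln_gt0.
- by rewrite sz size_cat !size_map -!cardE !cardsT !card_ord mul2n addnn.
- have e1 (i : nat) : (eta ^+ i) ^+ (2 * N) = 1.
    by rewrite exprAC (mulnC 2) exprM (prim_expr_order eta_prim) !expr1n.
  apply/allP => x; rewrite mem_cat => /orP[] /mapP[i _ ->]; rewrite rootE !hornerE.
    by rewrite e1 subrr.
  by rewrite exprM sqrrN -exprM e1 subrr.
- by rewrite uniq_rootsE uniq_roots_of.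
Qed.

Lemma rootsp_setC T1 T2 : rootsp T1 T2 * rootsp (~: T1) (~: T2) = 'X^(2 * N) - 1.
Proof.
rewrite -rootspT /rootsp mulrACA /MpolyL /MpolyLN; congr (_ * _).
  rewrite [RHS](bigID (mem T1)) /=; congr (_ * _);
    by apply: eq_bigl => i; rewrite !inE.
rewrite [RHS](bigID (mem T2)) /=; congr (_ * _);
    by apply: eq_bigl => i; rewrite !inE.
Qed.

Lemma Xn_sub1_pchar (R : idomainType) : p \in [pchar R] ->
  'X^len - 1 = ('X^(2 * N) - 1) ^+ P :> {poly R}.
Proof.
move=> cR; have cn : [pchar {poly R}].-nat P.
  by rewrite pnatX (eq_pnat _ (pchar_poly R)) pnatE // cR.
by rewrite exprDn_pchar // exprNn_pchar // expr1n -exprM.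
Qed.

(** The [q]-power Frobenius sends the factor at [i] to the factor at [q i]; on a stable [T] it only
    permutes the factors, so the coefficients descend to [F]. This justifies the choice made by
    [epsilon] in [Mpoly]. *)
Lemma MpolyP T : mul_stable q T -> map_poly iota (Mpoly iota eta T) = MpolyL eta T.
Proof.
move=> sT; rewrite /Mpoly; apply: (epsilon_spec (inhabits 0)
  (fun f : {poly F} => map_poly iota f = MpolyL eta T)).
apply: map_poly_descent => i; have [phi phiE] := pow_pchar_rmorphism s pcharL.
rewrite cardF qE -phiE -coef_map; congr (polyseq _)`_i.
rewrite /MpolyL rmorph_prod -{2}(mul_stable_imset coqN sT) big_imset /=; last first.
  by move=> ? ? _ _; apply: mulI_inj.
apply: eq_bigr => j _; rewrite map_polyXsubC phiE -qE val_mulI.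
by rewrite prim_expr_mod // exprM.
Qed.

Lemma monic_MpolyL T : MpolyL eta T \is monic.
Proof. by rewrite monic_prod // => i _; rewrite monicXsubC. Qed.

Lemma monic_MpolyLN T : MpolyLN T \is monic.
Proof. by rewrite monic_prod // => i _; rewrite monicXaddC. Qed.

Lemma hatp_MpolyP T : mul_stable q T -> map_poly iota (hatp (Mpoly iota eta T)) = MpolyL eta T.
Proof.
move=> sT; have : hatp (Mpoly iota eta T) = Mpoly iota eta T; last by move->; apply: MpolyP.
rewrite /hatp (monicP _) ?invr1 ?scale1r //.
by rewrite -(map_monic iota) MpolyP // monic_MpolyL.
Qed.

(** The substitution turns each factor into [- ('X + eta ^ i)]; [hatp] removes the resulting
    sign. *)
Lemma hatp_negX_MpolyP T : mul_stable q T ->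
  map_poly iota (hatp (negX (Mpoly iota eta T))) = MpolyLN T.
Proof.
move=> sT; rewrite /hatp map_polyZ fmorphV -lead_coef_map /negX.
rewrite map_comp_poly MpolyP // rmorphN /= map_polyX /MpolyL.
have -> : (\prod_(i in T) ('X - (eta ^+ i)%:P)) \Po - 'X = (-1) ^+ #|T| *: MpolyLN T.
  rewrite (big_morph (fun f => f \Po - 'X) (fun f g => comp_polyM f g _) (comp_polyC 1 _)).
  rewrite (eq_bigr (fun i : 'I_N => - ('X + (eta ^+ i)%:P))) => [|i _]; last first.
    by rewrite comp_polyB comp_polyX comp_polyC opprD.
  by rewrite prodrN -mul_polyC rmorphXn rmorphN1.
rewrite lead_coefZ (monicP (monic_MpolyLN T)) mulr1 scalerA mulVf ?scale1r //.
by rewrite signr_eq0.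
Qed.

(** For [q]-stable sets, its roots in [L] are [eta ^ i] with [i] in [T1] and [- eta ^ i] with [i] in
    [T2], all of multiplicity [p ^ n]. *)
Definition lcd_gen T1 T2 : {poly F} :=
  (Mpoly iota eta T1 * hatp (negX (Mpoly iota eta T2))) ^+ P.

Lemma map_lcd_gen T1 T2 : mul_stable q T1 -> mul_stable q T2 ->
  map_poly iota (lcd_gen T1 T2) = rootsp T1 T2 ^+ P.
Proof.
by move=> s1 s2; rewrite /lcd_gen rmorphXn rmorphM /= MpolyP // hatp_negX_MpolyP.
Qed.

Lemma monic_lcd_gen T1 T2 : mul_stable q T1 -> mul_stable q T2 -> lcd_gen T1 T2 \is monic.
Proof.
move=> s1 s2; rewrite -(map_monic iota) map_lcd_gen // monic_exp //.
by rewrite rootspE monic_prod_XsubC.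
Qed.

Lemma lcd_gen_setC T1 T2 : mul_stable q T1 -> mul_stable q T2 ->
  lcd_gen T1 T2 * lcd_gen (~: T1) (~: T2) = 'X^len - 1.
Proof.
move=> s1 s2; apply: (map_poly_inj iota).
rewrite rmorphM /= !map_lcd_gen ?mul_stableC // -exprMn rootsp_setC.
by rewrite rmorphB rmorph1 /= map_polyXn Xn_sub1_pchar.
Qed.

Lemma root_lcd_gen T1 T2 x : mul_stable q T1 -> mul_stable q T2 ->
  root (map_poly iota (lcd_gen T1 T2)) x = (x \in roots_of T1 T2).
Proof.
by move=> s1 s2; rewrite map_lcd_gen // (root_exp (mulrC _ _)) // rootspE root_prod_XsubC.
Qed.

Lemma lcd_gen_inj T1 T2 T1' T2' : mul_stable q T1 -> mul_stable q T2 ->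
  mul_stable q T1' -> mul_stable q T2' -> lcd_gen T1 T2 = lcd_gen T1' T2' -> T1 = T1' /\ T2 = T2'.
Proof.
move=> s1 s2 s1' s2' e; split; apply/setP => i.
  by rewrite -(mem_roots_of T1 T2) -root_lcd_gen // e root_lcd_gen // mem_roots_of.
by rewrite -(mem_roots_ofN T1 T2) -root_lcd_gen // e root_lcd_gen // mem_roots_ofN.
Qed.

(** Since [N] divides [len], the power [len.-1] inverts [eta ^ i]. *)
Lemma exp_len_pred (i : 'I_N) : (eta ^+ i) ^+ len.-1 = eta ^+ mulI N.-1 i.
Proof.
rewrite val_mulI prim_expr_mod // -exprM; apply/eqP; rewrite (eq_prim_root_expr eta_prim).
rewrite -(eqn_modDr i) -!mulnSr !prednK //.
by rewrite mulnAC !modnMl (mulnA i) modnMl.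
Qed.

Lemma opp_exp_len_pred x : (- x) ^+ len.-1 = - x ^+ len.-1 :> L.
Proof.
have : odd len.-1.
  by move: len_gt0; rewrite -mulnA mul2n; case: (_ * _)%N => // k _ /=; rewrite odd_double.
by rewrite exprNn -signr_odd => ->; rewrite expr1 mulN1r.
Qed.

Lemma lcd_genP T1 T2 : mul_stable q T1 -> mul_stable q T2 ->
  mul_stable N.-1 T1 -> mul_stable N.-1 T2 ->
  [/\ lcd_gen T1 T2 \is monic, lcd_gen T1 T2 %| 'X^len - 1,
      lcd_gen T1 T2 %| conjp len (lcd_gen T1 T2)
    & coprimep (lcd_gen T1 T2) (('X^len - 1) %/ lcd_gen T1 T2)].
Proof.
move=> s1 s2 n1 n2; have mg := monic_lcd_gen s1 s2.
have g0 := monic_neq0 mg.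
split=> //; first by rewrite -(lcd_gen_setC s1 s2) dvdp_mulr.
  (* Both sides are powers of exponent [P], so it suffices that the inverse of each root is a root;
     this is stability under [N.-1]. *)
  rewrite -(dvdp_map iota) /conjp map_comp_poly map_polyXn map_lcd_gen // rmorphXn /=.
  apply: dvdp_exp2r; rewrite {1}rootspE; apply: uniq_roots_dvdp.
    apply/allP => x xr; rewrite root_comp hornerXn rootspE root_prod_XsubC.
    move: xr; rewrite mem_cat => /orP[] /mapP[i]; rewrite mem_enum => iT ->.
      by rewrite exp_len_pred mem_roots_of; apply: (mul_stableP _ _ n1).
    by rewrite opp_exp_len_pred exp_len_pred mem_roots_ofN; apply: (mul_stableP _ _ n2).
  by rewrite uniq_rootsE uniq_roots_of.
rewrite -(lcd_gen_setC s1 s2) mulKp // -(coprimep_map iota) !map_lcd_gen ?mul_stableC //.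
rewrite coprimep_pexpl // coprimep_pexpr // rootspE coprimep_prod_XsubC.
apply/allP => x; rewrite rootspE root_prod_XsubC.
rewrite {1}mem_cat => /orP[] /mapP[i]; rewrite mem_enum => iT ->.
  by rewrite mem_roots_of inE iT.
by rewrite mem_roots_ofN inE iT.
Qed.

(** The sets are read off the roots of [g]. Frobenius and [g %| conjp len g] make them stable, and
    coprimality with the cofactor forces every root to have full multiplicity [P]. *)
Lemma lcd_gen_surj g : g \is monic -> g %| 'X^len - 1 -> g %| conjp len g ->
  coprimep g (('X^len - 1) %/ g) ->
  exists T1 T2, [/\ mul_stable q T1, mul_stable q T2, mul_stable N.-1 T1, mul_stable N.-1 T2
    & g = lcd_gen T1 T2].
Proof.
move=> mg gQ gg cg.
pose gL := map_poly iota g.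
pose T1 := [set i : 'I_N | root gL (eta ^+ i)].
pose T2 := [set i : 'I_N | root gL (- eta ^+ i)].
have rootq x : root gL x -> root gL (x ^+ q).
  have [phi phiE] := pow_pchar_rmorphism s pcharL.
  have gLphi : map_poly phi gL = gL.
    rewrite /gL -map_poly_comp; apply: eq_map_poly => a /=.
    by rewrite phiE -qE -cardF -rmorphXn expf_card.
  by rewrite -{2}gLphi qE -phiE !rootE horner_map => /eqP->; rewrite rmorph0.
have rootN x : root gL x -> root gL (x ^+ len.-1).
  move=> rx; have : gL %| gL \Po 'X^(len.-1).
    by rewrite /gL -(map_polyXn iota) -map_comp_poly dvdp_map.
  by move=> d; have := root_dvdp d rx; rewrite root_comp hornerXn.
(* Odd [q] keeps the two families of roots apart: [(- x) ^ q = - x ^ q]. *)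
have q_odd : odd q by rewrite qE oddX p_odd orbT.
have s1 : mul_stable q T1.
  apply/mul_stableP => i; rewrite !inE val_mulI prim_expr_mod // exprM; exact: rootq.
have s2 : mul_stable q T2.
  apply/mul_stableP => i; rewrite !inE val_mulI prim_expr_mod // exprM => /rootq.
  by rewrite exprNn -signr_odd q_odd expr1 mulN1r.
exists T1, T2; split=> //.
- by apply/mul_stableP => i; rewrite !inE -exp_len_pred; exact: rootN.
- by apply/mul_stableP => i; rewrite !inE -exp_len_pred -opp_exp_len_pred; exact: rootN.
apply: (map_poly_inj iota); rewrite map_lcd_gen // -/gL.
rewrite [LHS](@coprime_factor_prod_XsubC _ (roots_of setT setT) P _
  (map_poly iota (('X^len - 1) %/ g))) //.
- congr (_ ^+ _); rewrite /roots_of big_cat !big_map /=; congr (_ * _).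
    by rewrite big_enum_cond; apply: eq_bigl => i; rewrite !inE.
  rewrite big_enum_cond; apply: eq_big => i; first by rewrite !inE.
  by rewrite polyCN opprK.
- by rewrite map_monic.
- by rewrite coprimep_map.
- rewrite /gL -rmorphM /= mulrC divpK // rmorphB rmorph1 /= map_polyXn Xn_sub1_pchar //.
  by rewrite -rootspE rootspT.
Qed.

Lemma LCD_cyclic_stableP (C : {set 'rV[F]_len}) : is_LCD_cyclic C <->
  exists T1 T2, [/\ T1 \in (stables q N), T2 \in (stables q N) & C = gen_code len (lcd_gen T1 T2)].
Proof.
split=> [/(LCD_cyclicP len_gt0)[g [mg gQ gg cg ->]]|[T1 [T2 [+ + ->]]]].
  have [T1 [T2 [s1 s2 n1 n2 ->]]] := lcd_gen_surj mg gQ gg cg.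
  by exists T1, T2; rewrite !inE s1 s2 n1 n2.
rewrite !inE => /andP[s1 n1] /andP[s2 n2]; apply/(LCD_cyclicP len_gt0).
by have [? ? ? ?] := lcd_genP s1 s2 n1 n2; exists (lcd_gen T1 T2).
Qed.

Lemma card_LCD_cyclic :
  #|[set C : {set 'rV[F]_len} | is_LCD_cyclic C]| = (#|(stables q N)| ^ 2)%N.
Proof.
pose G (T : {set 'I_N} * {set 'I_N}) : {set 'rV[F]_len} := gen_code len (lcd_gen T.1 T.2).
have -> : [set C : {set 'rV[F]_len} | is_LCD_cyclic C] = G @: setX (stables q N) (stables q N).
  apply/setP => C; rewrite inE; apply/idP/imsetP => [/LCD_cyclic_stableP[T1 [T2 [t1 t2 ->]]]|].
    by exists (T1, T2); rewrite // inE t1.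
  case=> -[T1 T2]; rewrite inE => /andP[t1 t2] ->.
  by apply/LCD_cyclic_stableP; exists T1, T2.
rewrite card_in_imset ?cardsX ?mulnn // => -[T1 T2] [T1' T2'].
rewrite !inE /= => /andP[/andP[s1 n1] /andP[s2 n2]] /andP[/andP[s1' n1'] /andP[s2' n2']].
have [mg gQ _ _] := lcd_genP s1 s2 n1 n2; have [mg' gQ' _ _] := lcd_genP s1' s2' n1' n2'.
by move=> /(gen_code_inj len_gt0 mg mg' gQ gQ') /lcd_gen_inj[] // -> ->.
Qed.

End RootSets.

(** * The generators of the theorem *)

Lemma exp_expo (R : nzRingType) (x : R) p n (b : bool) : x ^+ expo p n b = (x ^+ b) ^+ (p ^ n).
Proof. by case: b; rewrite /expo ?expr1 ?expr0 ?expr1n. Qed.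

(** * Stable sets encoded by one bit per pair of opposite cosets *)

Section Packing.
Variables (l m q g : nat).
Hypotheses (l_pr : prime l) (l_odd : odd l) (m_gt0 : (0 < m)%N) (coql : coprime q l).
Hypotheses (cogl : coprime g l) (g_gen : ord_mod (l ^ m) g = totient (l ^ m)).
Hypothesis f_odd : odd (ord_mod l q).

Local Notation N := (l ^ m)%N.
Local Notation sym r k := (sym_coset N q (rep l m g r k)).

Let N_gt0 : (0 < N)%N. Proof. by rewrite expn_gt0 prime_gt0. Qed.
Let coqN : coprime q N. Proof. exact: coprimeXr. Qed.

Definition rep_idx : seq (nat * nat) :=
  [seq (r, k) | r <- index_iota 1 m.+1, k <- index_iota 0 (delta l q r)./2].

Lemma mem_rep_idx r k :
  ((r, k) \in rep_idx) = (0 < r <= m)%N && (k < (delta l q r)./2)%N.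
Proof.
apply/allpairsPdep/andP => [[r' [k' [+ + [-> ->]]]]|[rb kb]].
  by rewrite !mem_index_iota.
by exists r, k; rewrite !mem_index_iota.
Qed.

(** Existence and uniqueness of representatives combined into a count, the form in which [prod_pack]
    needs them for exponents. *)
Lemma count_rep_idx (x : 'I_N) :
  count (fun a => x \in sym a.1 a.2) rep_idx = (x != 0 :> nat).
Proof.
have [x0|x0] /= := eqVneq (x : nat) 0%N.
  apply/eqP; rewrite -leqn0 leqNgt -has_count; apply/hasPn => -[r k].
  rewrite mem_rep_idx => /andP[rb _]; apply/negP => /(sym_coset_neq0 l_pr m_gt0 coql cogl rb).
  by rewrite x0.
have [r [k [rb kb xr]]] := rep_exists l_pr l_odd m_gt0 coql cogl g_gen f_odd x0.
rewrite (eq_in_count (a2 := pred1 (r, k))) => [|[r' k']].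
  rewrite count_uniq_mem ?mem_rep_idx ?rb ?kb //.
  apply: allpairs_uniq_dep => [|r' _|[r1 k1] [r2 k2] _ _ /= [-> ->] //]; exact: iota_uniq.
rewrite mem_rep_idx /= => /andP[rb' kb']; apply/idP/eqP => [xr'|[-> ->] //].
exact: rep_unique xr' xr.
Qed.

(** The exponent 0 is its own opposite and gets a bit of its own; any other [x] follows the bit of
    the one pair that contains it. *)
Definition pack (b0 : bool) (eps : nat -> nat -> bool) : {set 'I_N} :=
  [set x : 'I_N | if x == 0 :> nat then b0
                  else has (fun a => (x \in sym a.1 a.2) && eps a.1 a.2) rep_idx].

Lemma pack_stables b0 eps : pack b0 eps \in stables q N.
Proof.
have sym_mem x y r k : y \in sym_coset N q (x : 'I_N) -> (x \in sym r k) = (y \in sym r k).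
  move=> /(sym_coset_eq N_gt0 coqN) e; apply/idP/idP => /(sym_coset_eq N_gt0 coqN) <-.
    by rewrite -e sym_coset_refl.
  by rewrite e sym_coset_refl.
apply/(mem_stables N_gt0 coqN) => x; rewrite inE => xT; apply/subsetP => y yx.
rewrite inE; have -> : (y == 0 :> nat) = (x == 0 :> nat).
  have := count_rep_idx x; rewrite (eq_count (a2 := fun a => y \in sym a.1 a.2)) => [|a].
    by rewrite count_rep_idx; do 2 case: eqP.
  exact: sym_mem.
rewrite -(eq_has (a1 := fun a => (x \in sym a.1 a.2) && eps a.1 a.2)) // => a.
by rewrite (sym_mem _ _ _ _ yx).
Qed.

Lemma stables_pack (T : {set 'I_N}) : T \in stables q N ->
  exists b0 eps, T = pack b0 eps.
Proof.
move=> /(mem_stables N_gt0 coqN) sT.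
(* Stability makes meeting [T] the same as being contained in [T], so the bit of a pair asks whether
   the pair meets [T]. *)
exists (Ordinal N_gt0 \in T), (fun r k => [exists x in sym r k, x \in T]).
apply/setP => x; rewrite inE.
case: eqP => [x0|/eqP x0]; first by rewrite (_ : x = Ordinal N_gt0) //; apply: val_inj.
have := count_rep_idx x; rewrite x0 => c1.
apply/idP/hasP => [xT|[[r k] _ /andP[/= xr /exists_inP[y yr yT]]]].
  have /hasP[[r k] rk /= xr] : has (fun a => x \in sym a.1 a.2) rep_idx by rewrite has_count c1.
  by exists (r, k); rewrite //= xr; apply/exists_inP; exists x.
apply: (subsetP (sT y yT)); rewrite (sym_coset_eq N_gt0 coqN yr).
by rewrite -(sym_coset_eq N_gt0 coqN xr) sym_coset_refl.
Qed.

(** An arbitrary [f] serves both ['X - eta ^ i] and ['X + eta ^ i]. The two cosets of a pair are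
    disjoint; after exchanging the products, the exponent of [f i] is the number of selected pairs
    that contain [i], which is 0 or 1. *)
Lemma prod_pack (R : comNzRingType) (f : 'I_N -> R) (b0 : bool)
    (eps : nat -> nat -> bool) :
  f (Ordinal N_gt0) ^+ b0 *
    \prod_(1 <= r < m.+1) \prod_(0 <= k < (delta l q r)./2)
      ((\prod_(i in cyc_coset N q (rep l m g r k)) f i) ^+ eps r k *
       (\prod_(i in cyc_coset N q (negm N (rep l m g r k))) f i) ^+ eps r k)
  = \prod_(i in pack b0 eps) f i.
Proof.
pose E (x : 'I_N) (a : nat * nat) := (x \in sym a.1 a.2) && eps a.1 a.2.
have -> : \prod_(1 <= r < m.+1) \prod_(0 <= k < (delta l q r)./2)
      ((\prod_(i in cyc_coset N q (rep l m g r k)) f i) ^+ eps r k *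
       (\prod_(i in cyc_coset N q (negm N (rep l m g r k))) f i) ^+ eps r k)
   = \prod_(a <- rep_idx) \prod_i f i ^+ E i a.
  rewrite big_allpairs_dep; apply: eq_big_nat => r rb; apply: eq_bigr => k _ /=.
  rewrite -exprMn -bigU /=; last first.
    rewrite -setI_eq0; apply/eqP/setP => x; rewrite in_setI in_set0.
    apply/negP => /andP[/(cyc_coset_mem_eq N_gt0 coqN) e /(cyc_coset_mem_eq N_gt0 coqN)].
    rewrite e; apply/eqP; apply: cyc_coset_opp_neq => //; exact: rep_ndvd.
  rewrite /E /=; case: (eps r k).
    by rewrite expr1 big_mkcond; apply: eq_bigr => i _; rewrite andbT in_setU inE; case: (_ || _).
  by rewrite expr0 big1 // => i _; rewrite andbF.
rewrite exchange_big /=.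
under eq_bigr => i _ do rewrite prodrXr.
rewrite [RHS]big_mkcond (bigD1 (Ordinal N_gt0)) //= [RHS](bigD1 (Ordinal N_gt0)) //=.
have sumE i : (\sum_(a <- rep_idx) E i a = count (E i) rep_idx)%N.
  by rewrite -sum1_count [RHS]big_mkcond; apply: eq_bigr => a _; case: (E i a).
have countE i : (count (E i) rep_idx <= (i != 0 :> nat))%N.
  by rewrite -count_rep_idx; apply: sub_count => a /andP[].
rewrite mulrA; congr (_ * _).
  have := countE (Ordinal N_gt0); rewrite -sumE leqn0 => /eqP->.
  by rewrite expr0 mulr1 inE /=; case: b0.
apply: eq_bigr => i i0; have {}i0 : (i : nat) != 0%N := i0.
rewrite sumE inE (negPf i0).
have := leq_trans (countE i) (leq_b1 _); rewrite has_count.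
by case: (count _ _) => [|[]].
Qed.

End Packing.

(** * The explicit generators as values of [lcd_gen] *)

Section Generators.
Variables (p q s l m n g : nat) (F : finFieldType) (L : fieldType)
  (iota : {rmorphism F -> L}) (eta : L).
Hypotheses (p_pr : prime p) (p_odd : odd p) (cardF : #|F| = q) (qE : q = (p ^ s)%N).
Hypotheses (l_pr : prime l) (l_odd : odd l) (m_gt0 : (0 < m)%N) (coql : coprime q l).
Hypothesis eta_prim : (l ^ m)%N.-primitive_root eta.

Local Notation N := (l ^ m)%N.

Let N_gt0 : (0 < N)%N. Proof. by rewrite expn_gt0 prime_gt0. Qed.
Let coqN : coprime q N. Proof. exact: coprimeXr. Qed.
Let N_odd : odd N. Proof. by rewrite oddX l_odd orbT. Qed.

Let MtP t : map_poly iota (Mt iota eta N q t) = MpolyL eta (cyc_coset N q t).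
Proof. by apply: MpolyP p_pr cardF qE coqN eta_prim _ _; apply: stable_cyc_coset. Qed.

Let hatp_negX_MtP t :
  map_poly iota (hatp (negX (Mt iota eta N q t))) = MpolyLN eta (cyc_coset N q t).
Proof. by apply: hatp_negX_MpolyP p_pr cardF qE coqN eta_prim _ _; apply: stable_cyc_coset. Qed.

(** Both sides are compared over [L], where ['X - 1] and ['X + 1] are the factors at exponent 0. *)
Lemma gen_i_pack b0 c0 eps sig : coprime g l -> ord_mod N g = totient N ->
  odd (ord_mod l q) ->
  gen_i iota eta p q l m n g b0 c0 eps sig
  = lcd_gen p n iota eta (pack l m q g b0 eps) (pack l m q g c0 sig).
Proof.
move=> cogl g_gen f_odd; apply: (map_poly_inj iota).
have st b e : mul_stable q (pack l m q g b e).
  have := pack_stables l_pr l_odd m_gt0 coql cogl g_gen f_odd b e.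
  by rewrite inE => /andP[].
rewrite (map_lcd_gen n iota p_pr cardF qE coqN eta_prim) // /rootsp.
rewrite /MpolyL -(prod_pack l_pr l_odd m_gt0 coql cogl g_gen f_odd).
rewrite /MpolyLN -(prod_pack l_pr l_odd m_gt0 coql cogl g_gen f_odd).
rewrite mulrACA -big_split /= !exprMn -!exp_expo /gen_i !rmorphM !rmorphXn /=.
rewrite rmorphB rmorphD /= map_polyX rmorph1; congr (_ * _).
rewrite rmorph_prod -prodrXl; apply: eq_bigr => r _.
rewrite rmorph_prod -big_split -prodrXl; apply: eq_bigr => k _ /=.
rewrite !rmorphM !rmorphXn /= !MtP !hatp_negX_MtP !exprMn -!exp_expo.
by rewrite !mulrA.
Qed.

Lemma gen_ii_cover eps sig :
  gen_ii iota eta p q n eps sig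
  = lcd_gen p n iota eta (cover [set C in cyc_cosets N q | eps C])
      (cover [set C in cyc_cosets N q | sig C]).
Proof.
apply: (map_poly_inj iota).
have cosetE x y : x \in cyc_coset N q (y : 'I_N) -> cyc_coset N q (x : 'I_N) = cyc_coset N q y.
  exact: cyc_coset_mem_eq.
have sub e : [set C in cyc_cosets N q | e C] \subset cyc_cosets N q.
  by apply/subsetP => C; rewrite inE => /andP[].
have st e : mul_stable q (cover [set C in cyc_cosets N q | e C]).
  by apply/(stable_cosetP N_gt0 coqN) => x; apply: cover_cosets_saturated.
rewrite (map_lcd_gen n iota p_pr cardF qE coqN eta_prim) // /rootsp /MpolyL /MpolyLN.
rewrite !big_trivIset ?(trivIset_blocks cosetE) //.
have inE' e : (fun C => C \in [set C in cyc_cosets N q | e C])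
   =1 (fun C => (C \in cyc_cosets N q) && e C) by move=> C; rewrite inE.
rewrite !(eq_bigl _ _ (inE' _)) !big_mkcondr -big_split -prodrXl rmorph_prod /=.
apply: eq_bigr => C /imsetP[t _ ->].
rewrite rmorphM !rmorphXn /= exprMn.
have sC : mul_stable q (cyc_coset N q t) by apply: stable_cyc_coset.
rewrite (hatp_MpolyP iota p_pr cardF qE coqN eta_prim) //.
rewrite (hatp_negX_MpolyP iota p_pr cardF qE coqN eta_prim) // !exp_expo.
by case: (eps _); case: (sig _).
Qed.

End Generators.

Theorem theorem4p4 (p q s l m n : nat) (F : finFieldType) (L : fieldType)
    (iota : {rmorphism F -> L}) (eta : L) (g : nat) :
  prime p -> odd p -> #|F| = q -> q = (p ^ s)%N -> (0 < s)%N ->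
  prime l -> odd l -> l != p -> (0 < m)%N -> (0 < n)%N ->
  (l ^ m)%N.-primitive_root eta ->
  coprime g l -> ord_mod (l ^ m) g = totient (l ^ m) ->
  (odd (ord_mod l q) ->
     (forall C : {set 'rV[F]_(2 * l ^ m * p ^ n)},
        is_LCD_cyclic C <->
        exists (b0 c0 : bool) (eps sig : nat -> nat -> bool),
          C = gen_code _ (@gen_i F L iota eta p q l m n g b0 c0 eps sig)) /\
     #|[set C : {set 'rV[F]_(2 * l ^ m * p ^ n)} | is_LCD_cyclic C]|
       = (2 ^ ((#|cyc_cosets (l ^ m) q| - 1) + 2))%N) /\
  (~~ odd (ord_mod l q) ->
     (forall C : {set 'rV[F]_(2 * l ^ m * p ^ n)},
        is_LCD_cyclic C <->
        exists eps sig : {set 'I_(l ^ m)} -> bool,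
          C = gen_code _ (@gen_ii F L iota eta p q l m n eps sig)) /\
     #|[set C : {set 'rV[F]_(2 * l ^ m * p ^ n)} | is_LCD_cyclic C]|
       = (2 ^ (2 * ((#|cyc_cosets (l ^ m) q| - 1) + 1)))%N).
Proof.
move=> p_pr p_odd cardF qE s_gt0 l_pr l_odd lp m_gt0 _ eta_prim cogl g_gen.
have coql : coprime q l by rewrite qE coprimeXl // prime_coprime // dvdn_prime2 // eq_sym.
have coqN : coprime q (l ^ m) by rewrite coprimeXr.
have N_gt0 : (0 < l ^ m)%N by rewrite expn_gt0 prime_gt0.
have N_odd : odd (l ^ m) by rewrite oddX l_odd orbT.
have LCDP := @LCD_cyclic_stableP p q s n (l ^ m) F L iota eta
  p_pr p_odd cardF qE N_odd coqN eta_prim.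
have cardLCD := @card_LCD_cyclic p q s n (l ^ m) F L iota eta
  p_pr p_odd cardF qE N_odd coqN eta_prim.
have K_gt0 : (0 < #|cyc_cosets (l ^ m) q|)%N.
  by apply/card_gt0P; exists (cyc_coset (l ^ m) q (Ordinal N_gt0)); apply: imset_f.
split=> [f_odd|f_even]; split.
- move=> C; rewrite LCDP; split=> [[T1 [T2 [t1 t2 ->]]]|[b0 [c0 [eps [sig ->]]]]].
    have [b0 [eps ->]] := stables_pack l_pr l_odd m_gt0 coql cogl g_gen f_odd t1.
    have [c0 [sig ->]] := stables_pack l_pr l_odd m_gt0 coql cogl g_gen f_odd t2.
    exists b0, c0, eps, sig.
    by rewrite (gen_i_pack n iota p_pr cardF qE l_pr l_odd m_gt0 coql eta_prim).
  exists (pack l m q g b0 eps), (pack l m q g c0 sig).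
  by rewrite (gen_i_pack n iota p_pr cardF qE l_pr l_odd m_gt0 coql eta_prim) // !pack_stables.
(* With [e + 1] cosets there are [(e + 2) / 2] orbits under [q] and -1, and a code is given by two
   unions of orbits. *)
- rewrite cardLCD card_stables // -expnM muln2 -mul2n -card_sym_cosets //.
    by congr (2 ^ _)%N; lia.
  move=> x x0; apply: cyc_coset_opp_neq => //.
  by apply: contraTN (ltn_ord x) => /dvdn_leq; rewrite lt0n x0 -leqNgt; apply.
- have opp := stables_opp_power N_gt0 coqN (even_ord_opp l_pr l_odd coql m_gt0 f_even).
  have stP (T : {set 'I_(l ^ m)}) :
      reflect (forall x, x \in T -> cyc_coset (l ^ m) q x \subset T) (T \in stables q (l ^ m)).
    by rewrite opp inE; apply: forall_inP.
  move=> C; rewrite LCDP; split=> [[T1 [T2 [/stP t1 /stP t2 ->]]]|[eps [sig ->]]].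
    (* A stable set is the union of the cosets that it contains. *)
    exists (fun B : {set 'I_(l ^ m)} => B \subset T1), (fun B : {set 'I_(l ^ m)} => B \subset T2).
    rewrite (gen_ii_cover n iota p_pr cardF qE l_pr coql eta_prim).
    have refl x : x \in cyc_coset (l ^ m) q (x : 'I_(l ^ m)) by apply: cyc_coset_refl.
    by rewrite !(saturated_cover refl).
  rewrite (gen_ii_cover n iota p_pr cardF qE l_pr coql eta_prim).
  by eexists; eexists; split; last reflexivity; apply/stP => x; apply: cover_cosets_saturated.
- rewrite cardLCD (stables_opp_power N_gt0 coqN) ?card_saturated //.
  + by rewrite subnK // -expnM mulnC.
  + by move=> x; apply: cyc_coset_refl.
  + by move=> x y; apply: cyc_coset_mem_eq.
  + exact: even_ord_opp.
Qed.
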